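(* Let $0<\alpha\le2$, $\alpha<n$. Let $A\subset\mathbb R^n$ be such that $\mathcal E^+(A)$ is strongly closed in $\mathcal E^+$, and assume that $A$ is not inner $\alpha$-thin at infinity. Let $f=-U^\delta$ with $\delta=\tau+\sigma$, where $\tau\in\mathcal E^+$ and $\sigma\in\mathfrak M^+$ is bounded with $\inf_{x\in S(\sigma),\,y\in A}|x-y|>0$. Assume that $\delta(\mathbb R^n)>1$, that $U^\delta$ is continuous on $\overline A$, and that the limit $$\lim_{|x|\to\infty,\ x\in A}U^\delta(x)$$ exists. Then the minimizer $\lambda_{A,f}$ has compact support.
   Context: Fix $n\ge2$. $\mathfrak M$ is the space of real-valued (signed) Radon measures $\mu$ on $\mathbb R^n$, always assumed to satisfy $\int_{|y|>1}|y|^{\alpha-n}\,d|\mu|(y)<\infty$; $\mathfrak M^+$ is the cone of positive ones; bounded means $|\mu|(\mathbb R^n)<\infty$; $S(\mu)$ is the support (distance from $\varnothing$ is $+\infty$). $U^\mu(x)=\int|x-y|^{\alpha-n}\,d\mu(y)$, $I(\mu,\nu)=\iint|x-y|^{\alpha-n}\,d\mu(x)\,d\nu(y)$, $I(\mu)=I(\mu,\mu)$. $\mathcal E$ is the pre-Hilbert space of $\mu\in\mathfrak M$ of finite energy, with inner product $I(\mu,\nu)$ and norm $\|\mu\|=\sqrt{I(\mu)}$; the norm topology is called strong; $\mathcal E^+=\mathcal E\cap\mathfrak M^+$. For $Q\subset\mathbb R^n$: $\mathfrak M^+(Q)$ is the set of $\mu\in\mathfrak M^+$ for which $\mathbb R^n\setminus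 Q$ is $\mu$-negligible; $\mathcal E^+(Q)=\mathcal E\cap\mathfrak M^+(Q)$; $\breve{\mathcal E}^+(Q)=\{\mu\in\mathcal E^+(Q):\mu(\mathbb R^n)=1\}$. Inner capacity: $c_*(Q)=1/\inf\{I(\mu):\mu\in\breve{\mathcal E}^+(Q)\}$ (with $\inf\varnothing=+\infty$, $1/(+\infty)=0$, $1/0=+\infty$). $Q\subset\mathbb R^n$ is inner $\alpha$-thin at infinity if $\sum_{k\in\mathbb N}c_*(Q_k)/q^{k(n-\alpha)}<\infty$, where $q\in(1,\infty)$ and $Q_k:=Q\cap\{x:q^k\le|x|<q^{k+1}\}$. $\breve{\mathcal E}^+_f(A)$ is the set of $\mu\in\breve{\mathcal E}^+(A)$ for which $f$ is $\mu$-integrable, $I_f(\mu)=I(\mu)+2\int f\,d\mu$, $w_f(A)=\inf_{\mu\in\breve{\mathcal E}^+_f(A)}I_f(\mu)$. The minimizer $\lambda_{A,f}$ is the measure in $\breve{\mathcal E}^+_f(A)$ with $I_f(\lambda_{A,f})=w_f(A)$; it is unique, and it exists under the hypotheses of the claim. *)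

(* Defs.v *)
From HB Require Import structures.
From mathcomp Require Import all_boot all_order all_algebra.
From mathcomp Require Import all_classical all_reals all_analysis.

Set Implicit Arguments.
Unset Strict Implicit.
Unset Printing Implicit Defensive.

Import Order.TTheory GRing.Theory Num.Theory.
Import numFieldNormedType.Exports.

Local Open Scope classical_set_scope.
Local Open Scope ring_scope.

(* The library's norm on 'rV[R]_n is the sup norm; it induces the same
   topology, but capacities and potentials need the Euclidean norm. *)
Definition enorm (R : realType) (n : nat) (x : 'rV[R]_n) : R :=
  Num.sqrt (\sum_(i < n) x 0 i ^+ 2).

Notation borelRn R n := (g_sigma_algebraType (@open 'rV[R]_n)).

Notation posmeasure R n := {measure set (borelRn R n) -> \bar R}.

Section RieszPotentials.
Context (R : realType) (n : nat) (alpha : R).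
Local Open Scope ereal_scope.

Implicit Types (mu nu : posmeasure R n) (Q A : set 'rV[R]_n).

(* |x - y|^(alpha - n), for alpha < n; the extended inverse satisfies
   0^-1 = +oo, so the kernel is +oo on the diagonal. *)
Definition riesz_kernel (x y : 'rV[R]_n) : \bar R :=
  ((enorm (x - y) `^ (n%:R - alpha))%:E)^-1.

Definition potential mu (x : 'rV[R]_n) : \bar R :=
  \int[mu]_y riesz_kernel x y.

Definition mutual_energy mu nu : \bar R :=
  \int[nu]_y \int[mu]_x riesz_kernel x y.

Definition energy mu : \bar R := mutual_energy mu mu.

(* On R^n, positive Radon measures are the Borel measures that are finite on
   compact sets. *)
Definition Mplus : set (posmeasure R n) :=
  [set mu : posmeasure R n | (forall K : set 'rV[R]_n, compact K -> mu K < +oo) /\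
    \int[mu]_(y in [set y | (1 < enorm y)%R])
      (enorm y `^ (alpha - n%:R))%:E < +oo].

Definition Eplus : set (posmeasure R n) :=
  [set mu : posmeasure R n | Mplus mu /\ energy mu < +oo].

Definition Mplus_on Q : set (posmeasure R n) :=
  [set mu : posmeasure R n | Mplus mu /\ mu.-negligible (~` Q)].

Definition Eplus_on Q : set (posmeasure R n) := Eplus `&` Mplus_on Q.

Definition Eplus1_on Q : set (posmeasure R n) :=
  [set mu : posmeasure R n | Eplus_on Q mu /\ mu setT = 1].

Definition bounded_measure mu := mu setT < +oo.

Definition msupport mu : set 'rV[R]_n :=
  ~` \bigcup_(V in [set V : set 'rV[R]_n | open V /\ mu V = 0]) V.

(* The norm of the signed measure mu - nu, with I(mu - nu, mu - nu) expanded by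
   bilinearity.  For mu and nu in Eplus the three terms are finite and the
   radicand is nonnegative. *)
Definition strong_dist mu nu : \bar R :=
  sqrte (energy mu - 2%:E * mutual_energy mu nu + energy nu).

Definition strongly_closed_in_Eplus (F : set (posmeasure R n)) :=
  forall mu, Eplus mu ->
    (forall e : R, (0 < e)%R -> exists2 nu, F nu & strong_dist mu nu < e%:E) ->
    F mu.

Definition inner_capacity Q : \bar R :=
  (ereal_inf [set energy mu | mu in Eplus1_on Q])^-1.

Definition shell (q : R) Q (k : nat) : set 'rV[R]_n :=
  Q `&` [set x | (q ^+ k <= enorm x < q ^+ k.+1)%R].

Definition inner_thin_at_infinity (q : R) Q :=
  \sum_(0 <= k <oo)
    (inner_capacity (shell q Q k) / (q `^ (k%:R * (n%:R - alpha)))%:E) < +oo.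

Definition Eplus1f_on (f : 'rV[R]_n -> \bar R) A : set (posmeasure R n) :=
  [set mu : posmeasure R n | Eplus1_on A mu /\
    mu.-integrable setT (f : borelRn R n -> \bar R)].

Definition gauss_energy (f : 'rV[R]_n -> \bar R) mu : \bar R :=
  energy mu + 2%:E * \int[mu]_x f x.

Definition gauss_inf (f : 'rV[R]_n -> \bar R) A : \bar R :=
  ereal_inf [set gauss_energy f mu | mu in Eplus1f_on f A].

Definition is_minimizer A (f : 'rV[R]_n -> \bar R) (lambda : posmeasure R n) :=
  Eplus1f_on f A lambda /\ gauss_energy f lambda = gauss_inf f A.

End RieszPotentials.

(* x tends to infinity in R^n *)
Definition nbhs_infty (R : realType) (n : nat) : set_system 'rV[R]_n :=
  [set P | exists M : R, forall x, M < enorm x -> P x].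

(* Main.v *)
Require Import Defs.
From HB Require Import structures.
From mathcomp Require Import all_boot all_order all_algebra.
From mathcomp Require Import all_classical all_reals all_analysis measurable_realfun.
From mathcomp Require Import lra ring.

Set Implicit Arguments.
Unset Strict Implicit.
Unset Printing Implicit Defensive.

Import Order.TTheory GRing.Theory Num.Theory.
Import numFieldNormedType.Exports.

Local Open Scope classical_set_scope.
Local Open Scope ring_scope.
Local Open Scope ereal_scope.

(** Write k(x,y) = |x-y|^(alpha-n).  Since A is not thin at infinity, its
    shells A_k carry measures mu_k with potential at most 1 such that the sum
    of the u_k = U^{mu_k}(0) diverges: normalize, on each shell, a measure of
    nearly minimal energy restricted to the set where its potential is small.
    The potential of mu_k is nearly constant u_k on large balls, is bounded by
    a multiple of u_k off three consecutive shells, and there it is at most 1.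

    Let c = I(lambda) - int U^delta dlambda.  Comparing lambda with
    (1 - t m) lambda + t mu gives int (U^lambda - U^delta) dmu >= c m for every
    mu of mass m on A.  Testing with the mu_k and summing over k shows c < 0:
    otherwise lambda, of mass 1, would dominate delta, of mass greater than 1,
    on every U^{mu_k}.  The limit of U^delta at infinity along A is 0, because
    a positive lower bound for U^delta on far shells would make the sum of the
    u_k converge.  Hence U^delta < -c/2 on A outside a ball, and testing with
    the restriction of lambda to that ball shows that lambda has no mass
    outside it. *)

(** * The Euclidean norm: triangle inequality and continuity *)

Section EuclideanNorm.
Context (R : realType) (n : nat).
Implicit Types (x y : 'rV[R]_n).
Local Open Scope ring_scope.

Lemma enorm_ge0 x : 0 <= enorm x. Proof. exact: sqrtr_ge0. Qed.

Lemma sqr_enorm x : enorm x ^+ 2 = \sum_(i < n) x 0 i ^+ 2.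
Proof. by rewrite sqr_sqrtr// sumr_ge0// => i _; rewrite sqr_ge0. Qed.

Lemma enormN x : enorm (- x) = enorm x.
Proof. by congr Num.sqrt; apply: eq_bigr => i _; rewrite mxE sqrrN. Qed.

Lemma enorm_distC x y : enorm (x - y) = enorm (y - x).
Proof. by rewrite -enormN opprB. Qed.

Lemma coord_le_enorm x i : `|x 0 i| <= enorm x.
Proof.
rewrite -sqrtr_sqr ler_sqrt; last by rewrite sumr_ge0// => j _; rewrite sqr_ge0.
by rewrite (bigD1 i)//= lerDl sumr_ge0// => j _; rewrite sqr_ge0.
Qed.

(* Lagrange's identity gives Cauchy-Schwarz. *)
Lemma enorm_inner_le x y : \sum_(i < n) x 0 i * y 0 i <= enorm x * enorm y.
Proof.
have [s0|s0] := leP (\sum_(i < n) x 0 i * y 0 i) 0.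
  by rewrite (le_trans s0)// mulr_ge0// enorm_ge0.
rewrite -(@ler_pXn2r _ 2)// ?nnegrE ?(ltW s0)// ?mulr_ge0 ?enorm_ge0//.
rewrite exprMn !sqr_enorm.
have : 0 <= \sum_(i < n) \sum_(j < n) (x 0 i * y 0 j - x 0 j * y 0 i) ^+ 2.
  by apply: sumr_ge0 => i _; apply: sumr_ge0 => j _; rewrite sqr_ge0.
have -> : \sum_(i < n) \sum_(j < n) (x 0 i * y 0 j - x 0 j * y 0 i) ^+ 2 =
   2 * ((\sum_(i < n) x 0 i ^+ 2) * (\sum_(i < n) y 0 i ^+ 2)) -
   2 * (\sum_(i < n) x 0 i * y 0 i) ^+ 2.
  transitivity (\sum_(i < n) \sum_(j < n) (x 0 i ^+ 2 * y 0 j ^+ 2) +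
    \sum_(i < n) \sum_(j < n) (y 0 i ^+ 2 * x 0 j ^+ 2) -
    2 * \sum_(i < n) \sum_(j < n) ((x 0 i * y 0 i) * (x 0 j * y 0 j))).
    rewrite mulr_sumr -sumrN -!big_split /=; apply: eq_bigr => i _.
    rewrite mulr_sumr -sumrN -!big_split /=; apply: eq_bigr => j _.
    ring.
  rewrite !mulr_suml expr2 mulr_suml.
  under eq_bigr do rewrite -mulr_sumr.
  under [X in _ + X - _]eq_bigr do rewrite -mulr_sumr.
  under [X in _ - _ * X]eq_bigr do rewrite -mulr_sumr.
  rewrite -!mulr_suml; ring.
by lra.
Qed.

Lemma ler_enormD x y : enorm (x + y) <= enorm x + enorm y.
Proof.
rewrite -(@ler_pXn2r _ 2)// ?nnegrE ?addr_ge0 ?enorm_ge0//.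
rewrite sqrrD !sqr_enorm.
under eq_bigr do rewrite mxE sqrrD.
rewrite !big_split /= lerD2r lerD2l -mulr2n lerMn2r /=.
exact: enorm_inner_le.
Qed.

Lemma enorm_dist_triangle z x y : enorm (x - y) <= enorm (x - z) + enorm (z - y).
Proof. by rewrite (le_trans _ (ler_enormD _ _))// subrKA. Qed.

Lemma ler_enormB x y : enorm (x - y) <= enorm x + enorm y.
Proof. by rewrite -(enormN y) ler_enormD. Qed.

Lemma lerB_enorm x y : enorm x - enorm y <= enorm (x - y).
Proof. by rewrite lerBlDr (le_trans _ (ler_enormD _ _))// subrK. Qed.

Lemma continuous_enorm : continuous (@enorm R n).
Proof.
move=> x; rewrite /enorm.
apply: (@continuous_comp _ _ _ (fun x : 'rV[R]_n => \sum_(i < n) x 0 i ^+ 2));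
  last exact: sqrt_continuous.
rewrite /index_enum; elim: (Finite.enum _) => [|i s ih].
  rewrite (_ : (fun _ => _) = cst 0); first exact: cst_continuous.
  by apply/funext => y; rewrite big_nil.
rewrite (_ : (fun _ => _) =
    (fun y : 'rV[R]_n => y 0 i ^+ 2) \+
    (fun y => \sum_(j <- s) y 0 j ^+ 2)); last first.
  by apply/funext => y; rewrite big_cons.
apply: continuousD => //.
apply: (@continuous_comp _ _ _ (fun y : 'rV[R]_n => y 0 i) (fun r : R => r ^+ 2)).
  exact: coord_continuous.
exact: exprn_continuous.
Qed.

End EuclideanNorm.

(** * Borel measurability of the norm and of the Riesz kernel *)

Section Measurability.
Context (R : realType) (n : nat).
Local Notation T := (borelRn R n).

Lemma open_measurable_borelRn (U : set 'rV[R]_n) :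
  open U -> measurable (U : set T).
Proof. by move=> oU; apply: sub_sigma_algebra. Qed.

Lemma closed_measurable_borelRn (U : set 'rV[R]_n) :
  closed U -> measurable (U : set T).
Proof.
by move=> cU; rewrite -(setCK U); apply: measurableC;
  apply: open_measurable_borelRn; exact: closed_openC.
Qed.

Lemma continuous_measurable_borelRn (f : 'rV[R]_n -> R) :
  continuous f -> measurable_fun setT (f : T -> R).
Proof.
move=> /continuousP cf; apply: (measurability _ (RGenOpens.measurableE R)).
move=> _ [_ [a [b ->] <-]]; rewrite setTI.
by apply: open_measurable_borelRn; exact/cf/interval_open.
Qed.

Lemma measurable_enorm : measurable_fun setT (@enorm R n : T -> R).
Proof. by apply: continuous_measurable_borelRn; exact: continuous_enorm. Qed.

Lemma measurable_enormB :
  measurable_fun setT (fun z : T * T => enorm ((z.1 : 'rV[R]_n) - z.2)).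
Proof.
rewrite /enorm.
have msqrt : measurable_fun setT (Num.sqrt : R -> R).
  by apply: continuous_measurable_fun; exact: sqrt_continuous.
apply: (measurableT_comp msqrt).
apply: measurable_sum => i; apply: measurable_funX.
rewrite (_ : (fun _ => _) =
    fun z : T * T => ((z.1 : 'rV[R]_n) 0 i - (z.2 : 'rV[R]_n) 0 i)%R); last first.
  by apply/funext => z; rewrite !mxE.
apply: measurable_funB; apply: (@measurableT_comp _ _ _ _ _ _
    (fun z : T => (z : 'rV[R]_n) 0 i)%R) => //;
  apply: continuous_measurable_borelRn; exact: coord_continuous.
Qed.

(** Since [alpha < n], the exponent n - alpha is nonzero, so the power vanishes exactly on the
    diagonal, where the extended inverse gives [+oo]. Measurability and all kernel estimates start
    from this form. *)
Lemma riesz_kernelE (alpha : R) (x y : 'rV[R]_n) : (alpha < n%:R)%R ->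
  riesz_kernel alpha x y =
    if enorm (x - y) == 0%R then +oo else (enorm (x - y) `^ (alpha - n%:R))%:E.
Proof.
move=> an; rewrite /riesz_kernel inver powR_eq0 subr_eq0 (gt_eqF an) andbT.
by case: ifP => // _; rewrite -powRN opprB.
Qed.

Lemma measurable_riesz_kernel (alpha : R) : (alpha < n%:R)%R ->
  measurable_fun setT (fun z : T * T => riesz_kernel alpha z.1 z.2).
Proof.
move=> an; rewrite (_ : (fun _ => _) = fun z : T * T =>
    if enorm ((z.1 : 'rV[R]_n) - z.2) == 0%R then +oo
    else (enorm ((z.1 : 'rV[R]_n) - z.2) `^ (alpha - n%:R))%:E); last first.
  by apply/funext => z; exact: riesz_kernelE.
apply: measurable_fun_ifT => //.
  by apply: measurable_fun_eqr => //; exact: measurable_enormB.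
apply/measurable_EFinP; apply: (measurableT_comp (measurable_powR _)).
exact: measurable_enormB.
Qed.

End Measurability.

(** * Sigma-finiteness, Tonelli's theorem and integrals against restricted measures *)

Section SigmaFinite.
Context d (T : measurableType d) (R : realType) (m : {measure set T -> \bar R}).

(** A copy of [m] indexed by the proof [s], so that instance inference finds the sigma-finite
    structure that Tonelli's theorem asks for. *)
Definition sigma_finite_of (s : sigma_finite setT m) : set T -> \bar R := m.

Variable s : sigma_finite setT m.

HB.instance Definition _ := Measure.copy (sigma_finite_of s) m.

HB.instance Definition _ :=
  Measure_isSigmaFinite.Build _ _ _ (sigma_finite_of s) s.

End SigmaFinite.

Section MeasureTools.
Local Open Scope ereal_scope.

Lemma ge0_integral_mrestr d (T : measurableType d) (R : realType)
    (mu : {measure set T -> \bar R}) (D : set T) (mD : measurable D)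
    (f : T -> \bar R) :
  measurable_fun setT f -> (forall x, 0 <= f x) ->
  \int[mrestr mu mD]_x f x = \int[mu]_(x in D) f x.
Proof.
move=> mf f0; have mDC : measurable (~` D) by exact: measurableC.
rewrite -[in LHS](setUv D) ge0_integral_setU//; last 2 first.
- exact: measurable_funS mf.
- by apply/disj_setPS; rewrite setICr.
rewrite [X in _ + X]null_set_integral ?adde0//; last 2 first.
- exact: measurable_funS mf.
- by rewrite /= /mrestr setICl measure0.
apply: eq_measure_integral => E mE ED.
by rewrite /= /mrestr setIidl.
Qed.

Lemma negligible_ge0_le_integral d (T : measurableType d) (R : realType)
    (mu : {measure set T -> \bar R}) (Q : set T) (f g : T -> \bar R) :
  mu.-negligible (~` Q) ->
  measurable_fun setT f -> (forall x, 0 <= f x) ->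
  measurable_fun setT g -> (forall x, 0 <= g x) ->
  (forall x, Q x -> f x <= g x) ->
  \int[mu]_x f x <= \int[mu]_x g x.
Proof.
move=> muQ mf f0 mg g0 fg; apply: ae_ge0_le_integral => //.
by apply: negligibleS muQ => x /= nfg Qx; apply: nfg => _; exact: fg.
Qed.

Lemma sigma_finite_integralC d1 d2 (T1 : measurableType d1)
    (T2 : measurableType d2) (R : realType) (m1 : {measure set T1 -> \bar R})
    (m2 : {measure set T2 -> \bar R}) (f : T1 * T2 -> \bar R) :
  sigma_finite setT m1 -> sigma_finite setT m2 ->
  measurable_fun setT f -> (forall z, 0 <= f z) ->
  [/\ measurable_fun setT (fun x => \int[m2]_y f (x, y)) &
      \int[m1]_x \int[m2]_y f (x, y) = \int[m2]_y \int[m1]_x f (x, y)].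
Proof.
move=> s1 s2 mf f0.
pose M1 : {sigma_finite_measure set T1 -> \bar R} := sigma_finite_of s1.
pose M2 : {sigma_finite_measure set T2 -> \bar R} := sigma_finite_of s2.
split.
  exact: (@measurable_fun_fubini_tonelli_F _ _ _ _ _ M2 f).
exact: (@fubini_tonelli _ _ _ _ _ M1 M2 f).
Qed.

End MeasureTools.

(** * Estimates for the Riesz kernel, the class [Mplus], and potentials *)

Section RieszKernel.
Context (R : realType) (n : nat) (alpha : R).
Hypothesis an : (alpha < n%:R)%R.
Local Notation T := (borelRn R n).
Local Notation k := (@riesz_kernel R n alpha).
Implicit Types (x y : 'rV[R]_n) (mu nu : posmeasure R n).

Lemma riesz_kernel_ge0 x y : 0 <= k x y.
Proof. by rewrite inve_ge0 lee_fin powR_ge0. Qed.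

Lemma riesz_kernelC x y : k x y = k y x.
Proof. by rewrite /riesz_kernel enorm_distC. Qed.

(** The kernel is a decreasing power of the distance, so a factor C in the distance costs
    C^(n-alpha). Every comparison of one potential at two points rests on this. *)
Lemma riesz_kernel_comparison C x x' y : (0 < C)%R ->
  (enorm (x' - y) <= C * enorm (x - y))%R ->
  k x y <= (C `^ (n%:R - alpha))%:E * k x' y.
Proof.
move=> C0 xx'; have C0' : (0 < C `^ (n%:R - alpha))%R by exact: powR_gt0.
(* If x = y then the hypothesis forces x' = y as well, so an infinite left side meets an infinite
   right side. *)
rewrite !riesz_kernelE//; have [xy0|xy0] := eqVneq (enorm (x - y)) 0%R.
  move: xx'; rewrite xy0 mulr0 => x'y0.
  by rewrite eq_le x'y0 enorm_ge0/= gt0_muley// lte_fin.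
have xyp : (0 < enorm (x - y))%R by rewrite lt_neqAle eq_sym xy0 enorm_ge0.
have [x'y0|x'y0] := eqVneq (enorm (x' - y)) 0%R.
  by rewrite gt0_muley ?leey// lte_fin.
have x'yp : (0 < enorm (x' - y))%R by rewrite lt_neqAle eq_sym x'y0 enorm_ge0.
rewrite -EFinM lee_fin -(opprB n%:R alpha) !powRN.
rewrite ler_pdivlMr ?powR_gt0// mulrC ler_pdivrMr ?powR_gt0//.
rewrite -powRM ?enorm_ge0 ?(ltW C0)//.
rewrite ge0_ler_powR// ?nnegrE ?enorm_ge0 ?mulr_ge0 ?enorm_ge0 ?(ltW C0)//.
by rewrite subr_ge0 ltW.
Qed.

Lemma riesz_kernel_le r x y : (0 < r)%R -> (r <= enorm (x - y))%R ->
  k x y <= (r `^ (alpha - n%:R))%:E.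
Proof.
move=> r0 rxy; rewrite riesz_kernelE// gt_eqF ?(lt_le_trans r0)// lee_fin.
rewrite -(opprB n%:R alpha) !powRN lef_pV2 ?posrE ?powR_gt0 ?(lt_le_trans r0)//.
by rewrite ge0_ler_powR ?nnegrE ?enorm_ge0 ?(ltW r0)// subr_ge0 ltW.
Qed.

Lemma riesz_kernel_ge r x y : (0 < r)%R -> (enorm (x - y) <= r)%R ->
  (r `^ (alpha - n%:R))%:E <= k x y.
Proof.
move=> r0 rxy; rewrite riesz_kernelE//; case: ifPn => [|xy0]; first by rewrite leey.
have xyp : (0 < enorm (x - y))%R by rewrite lt_neqAle eq_sym xy0 enorm_ge0.
rewrite lee_fin -(opprB n%:R alpha) !powRN lef_pV2 ?posrE ?powR_gt0//.
by rewrite ge0_ler_powR ?nnegrE ?enorm_ge0 ?(ltW r0)// subr_ge0 ltW.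
Qed.

Lemma measurable_riesz_kernel_l x : measurable_fun setT (k x : T -> \bar R).
Proof.
exact: (measurableT_comp (measurable_riesz_kernel an) (pair1_measurable (x : T))).
Qed.

Lemma measurable_enorm_powR p :
  measurable_fun setT (fun y : T => (enorm (y : 'rV[R]_n) `^ p)%R).
Proof. exact: (measurableT_comp (measurable_powR p) (@measurable_enorm R n)). Qed.

Lemma measurable_enorm_le r : measurable ([set y | (enorm y <= r)%R] : set T).
Proof.
rewrite (_ : [set _ | _] = setT `&` @enorm R n @^-1` `]-oo, r]).
  by apply: measurable_enorm => //; exact: measurable_itv.
by rewrite setTI; apply/seteqP; split => y /=; rewrite in_itv.
Qed.

Lemma measurable_enorm_lt r : measurable ([set y | (r < enorm y)%R] : set T).
Proof.
rewrite (_ : [set _ | _] = ~` [set y | (enorm y <= r)%R] :> set T).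
  by apply: measurableC; exact: measurable_enorm_le.
by apply/seteqP; split => y /=; rewrite ltNge => /negP.
Qed.

Lemma compact_enorm_le r : compact [set y : 'rV[R]_n | (enorm y <= r)%R].
Proof.
apply: bounded_closed_compact.
  exists r; split; first exact: num_real.
  move=> M rM y /= yr; rewrite [leLHS]/Num.norm/= mx_normrE.
  have M0 : (0 <= M)%R by rewrite (le_trans (enorm_ge0 y))// (le_trans yr) ?ltW.
  apply/bigmax_leP; split => // -[i j] _ /=.
  rewrite ord1 (le_trans (coord_le_enorm _ _))// (le_trans yr)//.
  exact: ltW.
rewrite (_ : [set _ | _] = @enorm R n @^-1` [set z | (z <= r)%R])//.
apply: closed_comp; last exact: closed_le.
by move=> x _; exact: continuous_enorm.
Qed.

Lemma Mplus_sigma_finite mu : Mplus alpha mu -> sigma_finite setT mu.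
Proof.
move=> [muK _]; exists (fun i => [set y : 'rV[R]_n | (enorm y <= i%:R)%R]).
  apply/seteqP; split => // y _.
  exists (Num.truncn (enorm y)).+1 => //=.
  by apply/ltW; have /andP[] := truncn_itv (enorm_ge0 y).
move=> i; split; first exact: measurable_enorm_le.
exact/muK/compact_enorm_le.
Qed.

(** Outside the unit ball |y|^(alpha-n) is at most 1, so the total mass bounds the growth
    integral. *)
Lemma finite_Mplus mu : mu setT < +oo -> Mplus alpha mu.
Proof.
move=> muT; split => [K cK|].
  apply: le_lt_trans muT; apply: le_measure; rewrite ?inE//.
  apply: closed_measurable_borelRn.
  exact: compact_closed (@norm_hausdorff _ _) cK.
apply: (@le_lt_trans _ _ (\int[mu]_(y in [set y | (1 < enorm y)%R]) cst 1 y)).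
  apply: ge0_le_integral.
  - exact: measurable_enorm_lt.
  - by move=> y _; rewrite lee_fin powR_ge0.
  - by apply: measurable_funTS; apply/measurable_EFinP; exact: measurable_enorm_powR.
  - exact: measurable_cst.
  - move=> y /= y1; rewrite lee_fin -(opprB n%:R alpha) powRN.
    have y0 : (0 < enorm y)%R by exact: lt_trans y1.
    rewrite invf_le1 ?powR_gt0// -[leLHS](powRr0 (enorm y)).
    by apply: ler_powR; [exact: ltW|rewrite subr_ge0 ltW].
rewrite integral_cst ?mul1e; last exact: measurable_enorm_lt.
apply: le_lt_trans muT; apply: le_measure; rewrite ?inE//.
exact: measurable_enorm_lt.
Qed.

Lemma Mplus_measure_add mu nu :
  Mplus alpha mu -> Mplus alpha nu -> Mplus alpha (measure_add mu nu).
Proof.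
move=> [muK muI] [nuK nuI]; split => [K cK|].
  by rewrite [X in X < _](measure_addE mu nu K) lte_add_pinfty ?muK ?nuK.
rewrite ge0_integral_measure_add//.
- by rewrite lte_add_pinfty.
- exact: measurable_enorm_lt.
- by move=> y _; rewrite lee_fin powR_ge0.
- apply: measurable_funTS; apply/measurable_EFinP; exact: measurable_enorm_powR.
Qed.

Lemma potential_ge0 mu x : 0 <= potential alpha mu x.
Proof. by apply: integral_ge0 => y _; exact: riesz_kernel_ge0. Qed.

Lemma mutual_energyE mu nu :
  mutual_energy alpha mu nu = \int[nu]_y potential alpha mu y.
Proof.
apply: eq_integral => y _; apply: eq_integral => x _; exact: riesz_kernelC.
Qed.

Lemma measurable_potential mu : Mplus alpha mu ->
  measurable_fun setT (potential alpha mu : T -> \bar R).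
Proof.
move=> /Mplus_sigma_finite s.
by have [] := sigma_finite_integralC s s (measurable_riesz_kernel an)
  (fun z => riesz_kernel_ge0 z.1 z.2).
Qed.

Lemma integral_potentialC mu nu : Mplus alpha mu -> Mplus alpha nu ->
  \int[nu]_x potential alpha mu x = \int[mu]_x potential alpha nu x.
Proof.
move=> /Mplus_sigma_finite s /Mplus_sigma_finite s'.
have [_ ->] := sigma_finite_integralC s' s (measurable_riesz_kernel an)
  (fun z => riesz_kernel_ge0 z.1 z.2).
by apply: eq_integral => x _; apply: eq_integral => y _; exact: riesz_kernelC.
Qed.

End RieszKernel.

(** The distances from x to F have infimum at least r > 0, so some point of F comes within twice the
    infimum. No nearest point has to exist, hence F may fail to be closed. *)
Lemma exists_near_point (R : realType) (n : nat) (F : set 'rV[R]_n)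
    (x : 'rV[R]_n) (r : R) :
  F !=set0 -> (0 < r)%R -> (forall y, F y -> r <= enorm (x - y))%R ->
  exists2 x', F x' & forall y, F y -> (enorm (x - x') <= 2 * enorm (x - y))%R.
Proof.
move=> [y0 Fy0] r0 Fr; pose D := [set enorm (x - y) | y in F].
have hD : has_inf D by split; [exists (enorm (x - y0)), y0|exists r => _ [y /Fr ? <-]].
have rD : (r <= inf D)%R.
  by apply: lb_le_inf; [case: hD|move=> _ [y /Fr ? <-]].
have D0 : (0 < inf D)%R by exact: lt_le_trans rD.
have [_ [x' Fx' <-] xx'] := inf_adherent D0 hD.
exists x' => // y Fy; apply: (le_trans (ltW xx')).
rewrite mulrDl mul1r lerD// ge_inf//; try exact: (proj2 hD).
- by exists y.
- by exists y.
Qed.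

(** * A weak maximum principle and measures with potential at most 1 *)

Section BoundedPotential.
Context (R : realType) (n : nat) (alpha : R).
Hypothesis an : (alpha < n%:R)%R.
Local Notation T := (borelRn R n).
Local Notation U := (@potential R n alpha).
Implicit Types (x y : 'rV[R]_n) (mu nu : posmeasure R n).

(* A weak maximum principle: E need not be closed, so x is compared with a
   nearly nearest point of each part of E at positive distance from x. *)
Lemma potential_mrestr_le nu (E : set T) (mE : measurable E) (b : R) x :
  (0 <= b)%R -> (forall y, E y -> U nu y <= b%:E) ->
  U (mrestr nu mE) x <= ((3 `^ (n%:R - alpha)) * b)%:E.
Proof.
move=> b0 Eb.
have c1 : (1 <= 3 `^ (n%:R - alpha) :> R)%R.
  by rewrite -[leLHS](powRr0 (3 : R)); apply: ler_powR; [lra|rewrite subr_ge0 ltW].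
have mk z := measurable_riesz_kernel_l an z.
rewrite /potential ge0_integral_mrestr//; last by move=> y; exact: riesz_kernel_ge0.
have EU (D : set T) z : measurable D -> \int[nu]_(y in D) riesz_kernel alpha z y <= U nu z.
  move=> mD; apply: ge0_subset_integral => // y _; exact: riesz_kernel_ge0.
have [Ex|Ex] := pselect (E x).
  rewrite (le_trans (EU _ _ mE))// (le_trans (Eb _ Ex))// lee_fin.
  by rewrite ler_peMl.
(* Here x lies outside E, so the sets F j increase to E, and monotone convergence reduces the bound
   to a single F j. *)
pose F j : set T := E `&` ~` [set y | (enorm (y - x) < j.+1%:R^-1)%R].
have mF j : measurable (F j).
  apply: measurableI => //; apply: closed_measurable_borelRn.
  rewrite (_ : ~` _ = (fun y : 'rV[R]_n => enorm (y - x)) @^-1`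
     [set z | (j.+1%:R^-1 <= z)%R]); last first.
    by apply/seteqP; split => y /=; rewrite leNgt => /negP.
  apply: closed_comp; last exact: closed_ge.
  move=> y _; apply: (@continuous_comp _ _ _ (fun y : 'rV[R]_n => y - x)%R).
    by apply: continuousB => //; exact: cst_continuous.
  exact: continuous_enorm.
have UF : \bigcup_j F j = E.
  apply/seteqP; split => [y [j _ []]//|y Ey].
  have yx : (0 < enorm (y - x))%R.
    rewrite lt_neqAle enorm_ge0 andbT eq_sym; apply/eqP => yx0; apply: Ex.
    suff -> : x = y by [].
    apply/rowP => i; apply/eqP; rewrite eq_sym -subr_eq0 -normr_le0 -yx0.
    by have := coord_le_enorm (y - x)%R i; rewrite !mxE.
  exists (Num.truncn (enorm (y - x))^-1) => //; split => //= /ltW.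
  apply/negP; rewrite -ltNge -[ltRHS]invrK ltf_pV2 ?posrE ?invr_gt0 ?ltr0n//.
  have yx' : (0 <= (enorm (y - x))^-1)%R by rewrite invr_ge0 ltW.
  by have /andP[] := truncn_itv yx'.
rewrite -UF.
have cv : \int[nu]_(y in F j) riesz_kernel alpha x y @[j --> \oo] -->
    \int[nu]_(y in \bigcup_j F j) riesz_kernel alpha x y.
  apply: ge0_nondecreasing_set_cvg_integral => //.
  - move=> i j ij; apply/subsetPset => y [Ey /= ny]; split => //= yj; apply: ny.
    by rewrite (lt_le_trans yj)// lef_pV2 ?posrE ?ltr0n// ler_nat.
  - by move=> i; exact: measurable_funTS.
  - by move=> i y _; exact: riesz_kernel_ge0.
rewrite -(cvg_lim _ cv)//; apply: lime_le; first by apply/cvg_ex; eexists; exact: cv.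
apply: nearW => j.
have [Fj0|/set0P/(exists_near_point (x := x) (r := j.+1%:R^-1))] := eqVneq (F j) set0.
  by rewrite Fj0 integral_set0 lee_fin mulr_ge0 ?powR_ge0.
case=> [||x' [Ex' _] xx'].
- by rewrite invr_gt0 ltr0n.
- by move=> y [_ /= /negP]; rewrite -leNgt enorm_distC.
(* The constant 3 is 2 + 1: on F j, |x' - y| <= |x' - x| + |x - y| <= 3 |x - y|. As x' belongs to E,
   the bound b is available at x'. *)
apply: (@le_trans _ _ (\int[nu]_(y in F j)
    ((3 `^ (n%:R - alpha))%:E * riesz_kernel alpha x' y))).
  apply: ge0_le_integral => //.
  - by move=> y _; exact: riesz_kernel_ge0.
  - exact: measurable_funTS.
  - by apply: measurable_funTS; exact: measurable_funeM.
  - move=> y Fy; apply: riesz_kernel_comparison => //.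
    rewrite (le_trans (enorm_dist_triangle x _ _))//.
    by rewrite enorm_distC; have := xx' _ Fy; lra.
rewrite ge0_integralZl//; last 2 first.
- exact: measurable_funTS.
- by move=> y _; exact: riesz_kernel_ge0.
rewrite EFinM lee_pmul2l ?lte_fin ?powR_gt0//.
by rewrite (le_trans (EU _ _ (mF j)))// Eb.
Qed.

Lemma Mplus_mrestr nu (E : set T) (mE : measurable E) :
  nu setT < +oo -> Mplus alpha (mrestr nu mE).
Proof.
move=> nuT; apply: finite_Mplus => //.
by apply: le_lt_trans nuT; apply: le_measure; rewrite ?inE//; exact: measurableI.
Qed.

Lemma potential_mscale (c : {nonneg R}) nu x :
  U (mscale c nu) x = (c%:num)%:E * U nu x.
Proof.
rewrite /potential ge0_integral_mscale//; first exact: measurable_riesz_kernel_l.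
by move=> y _; exact: riesz_kernel_ge0.
Qed.

Lemma mscale_mrestrE (c : {nonneg R}) nu (E D : set T) (mE : measurable E) :
  mscale c (mrestr nu mE) D = (c%:num)%:E * nu (D `&` E).
Proof. by []. Qed.

Lemma negligible_mscale_mrestr (c : {nonneg R}) nu (E : set T)
    (mE : measurable E) (Q : set T) :
  nu.-negligible Q -> (mscale c (mrestr nu mE)).-negligible Q.
Proof.
move=> [N [mN nuN QN]]; exists N; split => //.
have NE0 : nu (N `&` E) = 0.
  by apply: (subset_measure0 _ mN) => //; exact: measurableI.
by rewrite mscale_mrestrE NE0 mule0.
Qed.

(** The [nu]-integral of the potential of [nu] is at most e, so by Chebyshev's inequality this
    potential is at most 2e on a set E of measure at least 1/2. By the weak maximum principle the
    restriction to E has potential at most 2e 3^(n-alpha) everywhere; dividing by this number leaves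
    at least half its reciprocal as mass. *)
Lemma bounded_potential_exists (Q : set 'rV[R]_n) nu (e : R) :
  (0 < e)%R -> Eplus1_on alpha Q nu -> energy alpha nu <= e%:E ->
  exists mu : posmeasure R n, [/\ mu setT < +oo, mu.-negligible (~` Q),
    forall x, U mu x <= 1 & ((4 * 3 `^ (n%:R - alpha) * e)^-1)%:E <= mu setT].
Proof.
move=> e0 [[[Mnu _] [_ nuQ]] nu1] nue.
have nuoo : nu setT < +oo by rewrite nu1 ltry.
pose E : set T := [set x | U nu x <= (2 * e)%:E].
have mU : measurable_fun setT (U nu : T -> \bar R) by exact: measurable_potential.
have mE : measurable E.
  by rewrite -[E]setTI; apply: emeasurable_fun_infty_c.
have mEC : measurable (~` E) by exact: measurableC.
have nuEC : nu (~` E) <= (2^-1)%:E.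
  have e2 : (0 < 2 * e)%R by rewrite mulr_gt0.
  rewrite -(lee_pmul2l _ (_ : 0 < (2 * e)%:E)) ?lte_fin//.
  rewrite -EFinM mulrAC divff ?mul1r ?pnatr_eq0//.
  apply: le_trans nue; rewrite /energy mutual_energyE.
  have := le_integral_abse nu measurableT mU e2.
  under eq_integral do rewrite gee0_abs ?potential_ge0//.
  apply: le_trans; rewrite lee_pmul2l ?lte_fin//; apply: le_measure; rewrite ?inE//.
    apply: emeasurable_fun_c_infty => //.
    exact: measurableT_comp.
  move=> x /= /negP; rewrite -ltNge => /ltW; split => //.
  by rewrite gee0_abs ?potential_ge0.
have nuE : (2^-1)%:E <= nu E.
  have : nu E + nu (~` E) = 1 by rewrite -measureU ?setUv ?setICr.
  have fE : nu E \is a fin_num by rewrite ge0_fin_numE ?measure_ge0//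
    (le_lt_trans _ nuoo)// le_measure ?inE.
  have fEC : nu (~` E) \is a fin_num by rewrite ge0_fin_numE ?measure_ge0//
    (le_lt_trans _ nuoo)// le_measure ?inE.
  move: nuEC; rewrite -(fineK fE) -(fineK fEC) -EFinD !lee_fin => ? [?]; lra.
pose c := (2 * 3 `^ (n%:R - alpha) * e)^-1%R.
have p3 : (0 < 3 `^ (n%:R - alpha) :> R)%R by exact: powR_gt0.
have c0 : (0 < c)%R by rewrite invr_gt0 !mulr_gt0.
exists (mscale (NngNum (ltW c0)) (mrestr nu mE)); split.
- rewrite [X in X < _](mscale_mrestrE (NngNum (ltW c0)) nu setT mE) setTI lte_mul_pinfty ?lee_fin ?(ltW c0)//.
  by rewrite (le_lt_trans _ nuoo)// le_measure ?inE.
- exact: negligible_mscale_mrestr.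
- move=> x; rewrite potential_mscale /=.
  have e2 : (0 <= 2 * e)%R by rewrite mulr_ge0 ?ltW.
  have := @potential_mrestr_le nu E mE _ x e2 (fun y => id).
  rewrite -(lee_pmul2l _ (_ : 0 < c%:E)) ?lte_fin// => /le_trans; apply.
  by rewrite -EFinM lee_fin /c; rewrite le_eqVlt; apply/orP; left; apply/eqP; field; lra.
- rewrite [leRHS](mscale_mrestrE (NngNum (ltW c0)) nu setT mE) setTI.
  apply: (@le_trans _ _ (c%:E * (2^-1)%:E)).
    by rewrite -EFinM lee_fin /c; rewrite le_eqVlt; apply/orP; left; apply/eqP; field; lra.
  by rewrite lee_pmul2l ?lte_fin.
Qed.

End BoundedPotential.

(** Let t tend to 0. This extracts the first-order condition once the quadratic expansion of the
    energy has been divided by t. *)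
Lemma affine_ge0_near0 (R : realType) (c e t0 : R) : (0 < t0)%R ->
  (forall t, 0 < t <= t0 -> 0 <= c + t * e)%R -> (0 <= c)%R.
Proof.
move=> t00 ct; rewrite leNgt; apply/negP => c0.
have e1 : (0 < 2 * (`|e| + 1))%R by rewrite mulr_gt0 // ltr_wpDl.
(* If c < 0, this t gives t e <= -c/2 and thus c + t e < 0. The summand 1 keeps the denominator
   positive when e = 0. *)
pose t := Num.min t0 (- c / (2 * (`|e| + 1)))%R.
have t0' : (0 < t)%R by rewrite lt_min t00 divr_gt0// oppr_gt0.
have := ct t; rewrite t0' ge_min lexx => /(_ isT).
have te : (t * e <= t * (`|e| + 1))%R.
  by rewrite ler_pM2l// (le_trans (ler_norm e))// lerDl.
have : (t * (`|e| + 1) <= - c / 2)%R.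
  have : (t <= - c / (2 * (`|e| + 1)))%R by rewrite ge_min lexx orbT.
  by rewrite ler_pdivlMr// => ?; lra.
lra.
Qed.

Lemma ge0_lty_EFin (R : realType) (x : \bar R) :
  0 <= x -> x < +oo -> exists2 r : R, (0 <= r)%R & x = r%:E.
Proof. by case: x => [r r0 _|//|//]; exists r. Qed.

(** * The variational inequality for the minimizer *)

Section Variation.
Context (R : realType) (n : nat) (alpha : R).
Hypothesis an : (alpha < n%:R)%R.
Local Notation T := (borelRn R n).
Local Notation U := (@potential R n alpha).
Implicit Types (x y : 'rV[R]_n) (mu nu lambda delta : posmeasure R n).
Implicit Types (c d : {nonneg R}) (A : set 'rV[R]_n).

(** The coefficients are nonnegative, so the variation stays within positive measures. *)
Definition mcombination c mu d nu : posmeasure R n :=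
  measure_add (mscale c mu) (mscale d nu).

Lemma mcombinationE c mu d nu (D : set T) :
  mcombination c mu d nu D = (c%:num)%:E * mu D + (d%:num)%:E * nu D.
Proof. exact: measure_addE. Qed.

Lemma integral_mcombination c mu d nu (g : T -> \bar R) :
  measurable_fun setT g -> (forall x, 0 <= g x) ->
  \int[mcombination c mu d nu]_x g x =
    (c%:num)%:E * \int[mu]_x g x + (d%:num)%:E * \int[nu]_x g x.
Proof.
by move=> mg g0; rewrite ge0_integral_measure_add// !ge0_integral_mscale.
Qed.

Lemma potential_mcombination c mu d nu x :
  U (mcombination c mu d nu) x = (c%:num)%:E * U mu x + (d%:num)%:E * U nu x.
Proof.
rewrite /potential integral_mcombination//; first exact: measurable_riesz_kernel_l.
by move=> y; exact: riesz_kernel_ge0.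
Qed.

Lemma Mplus_mscale c mu : Mplus alpha mu -> Mplus alpha (mscale c mu).
Proof.
move=> [muK muI]; split => [K cK|].
  by rewrite [X in X < _]/= /mscale lte_mul_pinfty ?lee_fin ?muK.
rewrite ge0_integral_mscale//.
- by rewrite lte_mul_pinfty ?lee_fin.
- exact: measurable_enorm_lt.
- apply: measurable_funTS; apply/measurable_EFinP; exact: measurable_enorm_powR.
- by move=> y _; rewrite lee_fin powR_ge0.
Qed.

Lemma Mplus_mcombination c mu d nu :
  Mplus alpha mu -> Mplus alpha nu -> Mplus alpha (mcombination c mu d nu).
Proof. by move=> ? ?; apply: Mplus_measure_add; exact: Mplus_mscale. Qed.

Lemma negligible_mcombination c mu d nu (N : set T) :
  mu.-negligible N -> nu.-negligible N -> (mcombination c mu d nu).-negligible N.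
Proof.
move=> [N1 [mN1 muN1 NN1]] [N2 [mN2 nuN2 NN2]].
exists (N1 `&` N2); split; first exact: measurableI.
  rewrite [LHS]mcombinationE (subset_measure0 _ mN1 _ muN1)//; last exact: measurableI.
  rewrite (subset_measure0 _ mN2 _ nuN2)//; last exact: measurableI.
  by rewrite !mule0 adde0.
by move=> x Nx; split; [exact: NN1|exact: NN2].
Qed.

(** The two cross terms agree by the symmetry of the kernel. The integrals may be infinite, so each
    use of distributivity rests on nonnegativity. *)
Lemma energy_mcombination c mu d nu : Mplus alpha mu -> Mplus alpha nu ->
  energy alpha (mcombination c mu d nu) =
    (c%:num ^+ 2)%:E * energy alpha mu +
    (2 * c%:num * d%:num)%:E * \int[nu]_x U mu x +
    (d%:num ^+ 2)%:E * energy alpha nu.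
Proof.
move=> Mmu Mnu.
have mUmu : measurable_fun setT (U mu : T -> \bar R) by exact: measurable_potential.
have mUnu : measurable_fun setT (U nu : T -> \bar R) by exact: measurable_potential.
have pmu x : 0 <= U mu x by exact: potential_ge0.
have pnu x : 0 <= U nu x by exact: potential_ge0.
rewrite /energy !mutual_energyE.
under eq_integral do rewrite potential_mcombination.
rewrite integral_mcombination; last 2 first.
- by apply: emeasurable_funD; apply: measurable_funeM.
- by move=> x; rewrite adde_ge0// mule_ge0 ?lee_fin.
have I (m : posmeasure R n) : \int[m]_x ((c%:num)%:E * U mu x + (d%:num)%:E * U nu x) =
   (c%:num)%:E * \int[m]_x U mu x + (d%:num)%:E * \int[m]_x U nu x.
  rewrite ge0_integralD//; last 4 first.
  - by move=> x _; rewrite mule_ge0 ?lee_fin.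
  - exact: measurable_funeM.
  - by move=> x _; rewrite mule_ge0 ?lee_fin.
  - exact: measurable_funeM.
  by rewrite !ge0_integralZl.
rewrite !I (integral_potentialC an Mnu Mmu).
have i1 : 0 <= \int[mu]_x U mu x by apply: integral_ge0.
have i2 : 0 <= \int[nu]_x U mu x by apply: integral_ge0.
have i3 : 0 <= \int[nu]_x U nu x by apply: integral_ge0.
move: (\int[mu]_x U mu x) (\int[nu]_x U mu x) (\int[nu]_x U nu x) i1 i2 i3.
move=> {pmu pnu I} a b e a0 b0 e0.
rewrite !ge0_muleDr ?mule_ge0 ?lee_fin// !muleA -!EFinM -!expr2.
rewrite addeA; congr (_ + _); rewrite -addeA; congr (_ + _).
rewrite -ge0_muleDl ?lee_fin ?mulr_ge0// -EFinD.
by congr (_%:E * _); ring.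
Qed.

Lemma minimizer_finite A lambda delta : Mplus alpha delta ->
  is_minimizer alpha A (fun x => - U delta x) lambda ->
  \int[lambda]_x U delta x < +oo.
Proof.
move=> Md [[_ /integrableP[_ +]] _].
by under eq_integral do rewrite /= abseN gee0_abs ?potential_ge0//.
Qed.

(** With m the mass of [mu] and c = I(lambda) - int U^delta dlambda, this is int (U^lambda -
    U^delta) dmu >= c m, rearranged so that only nonnegative extended reals are added. It is the
    first-order condition at t = 0 along (1 - t m) lambda + t mu, which has mass 1 and is carried by
    A. *)
Lemma minimizer_variation A lambda delta mu :
  Mplus alpha delta -> is_minimizer alpha A (fun x => - U delta x) lambda ->
  Mplus alpha mu -> mu setT < +oo -> mu.-negligible (~` A) ->
  energy alpha mu < +oo -> \int[mu]_x U delta x < +oo ->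
  \int[mu]_x U lambda x < +oo ->
  energy alpha lambda * mu setT + \int[mu]_x U delta x <=
  \int[mu]_x U lambda x + \int[lambda]_x U delta x * mu setT.
Proof.
move=> Md lamin Mmu muoo muA emu dmu lmu.
have := minimizer_finite Md lamin; move: lamin => [[[[[Ml el] [_ lA]] l1] _] lmin] dl.
have mUd : measurable_fun setT (U delta : T -> \bar R) by exact: measurable_potential.
have pd x : 0 <= U delta x by exact: potential_ge0.
have i0 nu nu' : 0 <= \int[nu]_x U nu' x.
  by apply: integral_ge0 => x _; exact: potential_ge0.
have e0 nu : 0 <= energy alpha nu by rewrite /energy mutual_energyE.
have [m m0 mE] := ge0_lty_EFin (measure_ge0 mu setT) muoo.
have [a a0 aE] := ge0_lty_EFin (e0 lambda) el.
have [e _ eE] := ge0_lty_EFin (e0 mu) emu.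
have [b _ bE] := ge0_lty_EFin (i0 mu lambda) lmu.
have [s _ sE] := ge0_lty_EFin (i0 lambda delta) dl.
have [u _ uE] := ge0_lty_EFin (i0 mu delta) dmu.
(* The right side is the increment of the Gauss energy divided by t. The bound on t keeps 1 - t m
   nonnegative, and m + 1 is positive even when m = 0. *)
have key t : (0 < t <= (m + 1)^-1)%R ->
  (0 <= 2 * (- m * a + b + m * s - u) + t * (m ^+ 2 * a - 2 * m * b + e))%R.
  move=> /andP[t0 t1].
  have tm : (0 <= 1 - t * m)%R.
    have : (t * (m + 1) <= 1)%R by rewrite -ler_pdivlMr ?ltr_wpDl// div1r.
    by rewrite mulrDr mulr1; lra.
  pose nu := mcombination (NngNum tm) lambda (NngNum (ltW t0)) mu.
  have Mnu : Mplus alpha nu by exact: Mplus_mcombination.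
  have enuE := energy_mcombination (NngNum tm) (NngNum (ltW t0)) Ml Mmu.
  have dnuE := integral_mcombination (NngNum tm) lambda (NngNum (ltW t0)) mu mUd pd.
  rewrite aE bE eE -!(EFinM, EFinD) /= -/nu in enuE.
  rewrite uE sE -!(EFinM, EFinD) /= -/nu in dnuE.
  have nuE : Eplus1f_on alpha (fun x => - U delta x) A nu.
    split; first split.
    - split; first by split => //; rewrite enuE ltry.
      by split => //; exact: negligible_mcombination.
    - by rewrite [LHS]mcombinationE l1 mE -!(EFinM, EFinD) /= mulr1 subrK.
    - apply/integrableP; split; first exact: measurableT_comp.
      by under eq_integral do rewrite /= abseN gee0_abs ?potential_ge0//; rewrite dnuE ltry.
  have : gauss_energy alpha (fun x => - U delta x) lambda <=
      gauss_energy alpha (fun x => - U delta x) nu.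
    by rewrite lmin; apply: ereal_inf_lbound; exists nu.
  rewrite /gauss_energy !integral_ge0N// enuE dnuE aE sE.
  rewrite -!(EFinN, EFinM, EFinD) lee_fin => H.
  rewrite -(pmulr_rge0 _ t0); rewrite -subr_ge0 in H.
  apply: le_trans H _; rewrite le_eqVlt; apply/orP; left; apply/eqP; ring.
have p : (0 < (m + 1)^-1)%R by rewrite invr_gt0 ltr_wpDl.
have := affine_ge0_near0 p key.
by rewrite mE aE bE sE uE -!(EFinM, EFinD) lee_fin; lra.
Qed.

End Variation.

(** * Test measures on the shells and their relation to capacity *)

Section TestMeasures.
Context (R : realType) (n : nat) (alpha q : R).
Hypothesis an : (alpha < n%:R)%R.
Hypothesis q1 : (1 < q)%R.
Local Notation T := (borelRn R n).
Local Notation U := (@potential R n alpha).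
Implicit Types (x y : 'rV[R]_n) (mu nu : posmeasure R n) (A : set 'rV[R]_n).

Let q0 : (0 < q)%R. Proof. exact: lt_trans q1. Qed.
Let qk0 k : (0 < q ^+ k)%R. Proof. exact: exprn_gt0. Qed.

(** By [test_measure_exists] such measures have mass up to a fixed fraction of the capacity of the
    shell, so they can replace it in the series that defines thinness. *)
Definition test_measure A k mu := [/\ mu setT < +oo,
  mu.-negligible (~` shell q A k) & forall x, U mu x <= 1].

Lemma energy_ge0 mu : 0 <= energy alpha mu.
Proof.
rewrite /energy mutual_energyE; apply: integral_ge0 => x _; exact: potential_ge0.
Qed.

Lemma test_measureS A k mu : test_measure A k mu -> mu.-negligible (~` A).
Proof.
by move=> [_ + _]; apply: negligibleS; apply: subsetC => x [].
Qed.

Lemma test_potential_le A k mu x (c : \bar R) : 0 <= c -> test_measure A k mu ->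
  (forall y, shell q A k y -> riesz_kernel alpha x y <= c) ->
  U mu x <= c * mu setT.
Proof.
move=> c0 [muT muk _] kc; rewrite -integral_cst//.
apply: (negligible_ge0_le_integral muk) => //.
- exact: measurable_riesz_kernel_l.
- by move=> y; exact: riesz_kernel_ge0.
Qed.

Lemma test_potential_ge A k mu x (c : \bar R) : 0 <= c -> test_measure A k mu ->
  (forall y, shell q A k y -> c <= riesz_kernel alpha x y) ->
  c * mu setT <= U mu x.
Proof.
move=> c0 [muT muk _] kc; rewrite -integral_cst//.
apply: (negligible_ge0_le_integral muk) => //.
- exact: measurable_riesz_kernel_l.
- by move=> y; exact: riesz_kernel_ge0.
Qed.

Lemma test_potential_comparison A k mu x x' (C : R) : (0 < C)%R ->
  test_measure A k mu ->
  (forall y, shell q A k y -> enorm (x' - y) <= C * enorm (x - y))%R ->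
  U mu x <= (C `^ (n%:R - alpha))%:E * U mu x'.
Proof.
move=> C0 [muT muk _] kc.
have mk z := measurable_riesz_kernel_l an z.
have k0 z y : 0 <= riesz_kernel alpha z y by exact: riesz_kernel_ge0.
rewrite -ge0_integralZl ?lee_fin ?powR_ge0//.
apply: (negligible_ge0_le_integral muk) => //.
- exact: measurable_funeM.
- by move=> y; rewrite mule_ge0// lee_fin powR_ge0.
- by move=> y /kc; exact: riesz_kernel_comparison.
Qed.

Lemma test_potential0_le A k mu : test_measure A k mu ->
  U mu 0%R <= ((q ^+ k) `^ (alpha - n%:R))%:E * mu setT.
Proof.
move=> tmu; apply: test_potential_le tmu _; first by rewrite lee_fin powR_ge0.
move=> y [_ /andP[ky _]]; apply: riesz_kernel_le => //.
by rewrite sub0r enormN.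
Qed.

(** With [test_potential0_le], the potential at the origin equals q^(k(alpha-n)) times the mass up
    to a factor depending only on q, n and alpha. It therefore plays the part of the k-th term of
    the series. *)
Lemma test_potential0_ge A k mu : test_measure A k mu ->
  ((q ^+ k.+1) `^ (alpha - n%:R))%:E * mu setT <= U mu 0%R.
Proof.
move=> tmu; apply: test_potential_ge tmu _; first by rewrite lee_fin powR_ge0.
move=> y [_ /andP[_ /ltW ky]]; apply: riesz_kernel_ge => //.
by rewrite sub0r enormN.
Qed.

(** A capacity above c > 0 provides a unit measure of energy below 1/c, to which
    [bounded_potential_exists] applies. A real c strictly below the capacity is used because the
    capacity may be infinite and the infimum need not be attained. *)
Lemma test_measure_exists_above A k (c : R) :
  c%:E < inner_capacity alpha (shell q A k) ->
  exists2 mu, test_measure A k mu &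
    (c / (4 * 3 `^ (n%:R - alpha)))%:E <= mu setT.
Proof.
have p3 : (0 < 4 * 3 `^ (n%:R - alpha) :> R)%R by rewrite mulr_gt0 ?powR_gt0.
(* For c <= 0 the zero measure serves; the shell may then carry no unit measure of finite energy. *)
have [c0 _|c0] := leP c 0%R.
  exists mzero; last first.
    by rewrite [leRHS]/= /mzero lee_fin pmulr_lle0 ?invr_gt0.
  split.
  - by rewrite [ltLHS]/= /mzero ltry.
  - by exists (setT : set T); split.
  - by move=> x; rewrite /potential integral_measure_zero.
rewrite /inner_capacity => cc.
have [nu nuQ nue] : exists2 nu, Eplus1_on alpha (shell q A k) nu &
    energy alpha nu < (c^-1)%:E.
  have i0 : 0 <= ereal_inf [set energy alpha mu | mu in Eplus1_on alpha (shell q A k)].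
    by apply: le_ereal_inf_tmp => _ [nu _ <-]; apply: energy_ge0.
  move: cc; rewrite inve_pgt ?inE ?lee_fin ?(ltW c0)//.
  rewrite inver gt_eqF// => /ereal_inf_lt[_ [nu ? <-] ?]; exists nu => //.
have cV0 : (0 < c^-1)%R by rewrite invr_gt0.
have [mu [muT muQ mu1 mum]] := bounded_potential_exists an cV0 nuQ (ltW nue).
exists mu; first by split.
by apply: le_trans mum; rewrite lee_fin [leRHS]invfM invrK mulrC.
Qed.

End TestMeasures.

(** * Potentials of test measures away from their shell; divergence of the u_k *)

Section Shells.
Context (R : realType) (n : nat) (alpha q : R).
Hypothesis an : (alpha < n%:R)%R.
Hypothesis q1 : (1 < q)%R.
Local Notation T := (borelRn R n).
Local Notation U := (@potential R n alpha).
Implicit Types (x y : 'rV[R]_n) (mu nu : posmeasure R n) (A : set 'rV[R]_n).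

Let q0 : (0 < q)%R. Proof. exact: lt_trans q1. Qed.
Let qk0 k : (0 < q ^+ k)%R. Proof. exact: exprn_gt0. Qed.
Let theta0 : (0 < 1 - q^-1)%R. Proof. by rewrite subr_gt0 invf_lt1. Qed.

(* The shell number k together with its two neighbours. *)
Definition near_shell k : set T :=
  [set x : 'rV[R]_n | (q ^+ k <= q * enorm x < q ^+ k.+3)%R].

Lemma measurable_near_shell k : measurable (near_shell k).
Proof.
rewrite (_ : near_shell k = setT `&` @enorm R n @^-1`
    `[(q ^+ k / q)%R, (q ^+ k.+3 / q)%R[).
  by apply: measurable_enorm => //; exact: measurable_itv.
rewrite setTI; apply/seteqP.
by split=> x /=; rewrite in_itv/= ler_pdivrMr// ltr_pdivlMr// mulrC.
Qed.

Lemma mem_near_shell k x :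
  (x \in near_shell k) = (q ^+ k <= q * enorm x < q ^+ k.+3)%R.
Proof. by apply/idP/idP => [/set_mem|/mem_set]. Qed.

(** Written as a difference of two threshold functions three steps apart, the indicators telescope
    when summed over k. *)
Lemma indic_near_shell k x :
  \1_(near_shell k) x =
    ((q ^+ k <= q * enorm x)%R%:R - (q ^+ k.+3 <= q * enorm x)%R%:R)%R :> R.
Proof.
rewrite indicE mem_near_shell [in RHS](leNgt (q ^+ k.+3)%R).
have [qx|qx] := ltP (q * enorm x)%R (q ^+ k.+3)%R; rewrite ?andbT ?andbF ?subr0//=.
by rewrite (le_trans _ qx) ?subrr// ler_eXn2l// -addn3 leq_addr.
Qed.

Lemma sum_indic_near_shell N L x : (\sum_(N <= k < L) \1_(near_shell k) x <= 3 :> R)%R.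
Proof.
pose F k : R := (q ^+ k <= q * enorm x)%R%:R.
have F1 k : (0 <= F k <= 1)%R by rewrite /F; case: (q ^+ k <= _)%R; rewrite ?lexx ?ler01.
have [NL|LN] := leqP N L; last by rewrite big_geq ?ler0n// ltnW.
(* Adding the next three thresholds makes the sum independent of L. At L = N only those three terms
   remain, each at most 1. *)
suff : (\sum_(N <= k < L) \1_(near_shell k) x + F L + F L.+1 + F L.+2 <= 3 :> R)%R.
  by have := F1 L; have := F1 L.+1; have := F1 L.+2; lra.
rewrite -(subnKC NL); elim: (L - N)%N => [|d ih].
  by rewrite addn0 big_geq//; have := F1 N; have := F1 N.+1; have := F1 N.+2; lra.
rewrite addnS big_nat_recr ?leq_addr//= indic_near_shell.
by rewrite -/(F (N + d)%N) -/(F (N + d).+3); lra.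
Qed.

(** On the near shell the potential is at most 1. If |x| < q^(k-1), a point y of the shell satisfies
    |y| - |x| >= (1 - 1/q) q^k; if |x| >= q^(k+2), it satisfies |x| - |y| >= (1 - 1/q) |x|. Either
    way the maximum of |x| and q^k controls the distance. *)
Lemma test_potential_off_le A k mu x : test_measure alpha q A k mu ->
  U mu x <= (\1_(near_shell k) x)%:E +
    (((1 - q^-1) * Num.max (enorm x) (q ^+ k)) `^ (alpha - n%:R))%:E * mu setT.
Proof.
move=> tmu; set r := Num.max _ _.
have r0 : (0 < r)%R by rewrite lt_max qk0 orbT.
have c0 : 0 <= (((1 - q^-1) * r) `^ (alpha - n%:R))%:E * mu setT.
  by rewrite mule_ge0 ?lee_fin ?powR_ge0.
have [xk|xk] := boolP (x \in near_shell k).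
  rewrite indicE xk (le_trans _ (leeDl _ _))//.
  by case: tmu => _ _; exact.
rewrite indicE (negPf xk) add0e; apply: test_potential_le tmu _ => //.
  by rewrite lee_fin powR_ge0.
move=> y [_ /andP[ky yk]]; apply: riesz_kernel_le => //; first by rewrite mulr_gt0.
rewrite mulrBl mul1r.
have qy : (q^-1 * (q * enorm x) = enorm x)%R by rewrite mulKf// gt_eqF.
move: xk; rewrite mem_near_shell negb_and -ltNge -leNgt => /orP[xk|kx].
  have rk : r = (q ^+ k)%R.
    apply/max_idPr; apply: ltW; apply: le_lt_trans xk.
    by rewrite ler_peMl ?enorm_ge0// ltW.
  rewrite rk enorm_distC (le_trans _ (lerB_enorm _ _))// lerB//.
  by rewrite -qy ler_pM2l ?invr_gt0// ltW.
have kx' : (q ^+ k.+2 <= enorm x)%R by rewrite -(ler_pM2l q0) -exprS.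
have rk : r = enorm x.
  by apply/max_idPl; apply: le_trans kx'; rewrite ler_eXn2l// -addn2 leq_addr.
rewrite rk (le_trans _ (lerB_enorm _ _))// lerB// (le_trans (ltW yk))//.
by rewrite -(ler_pM2l q0) -exprS mulrA divff ?gt_eqF// mul1r.
Qed.

(** Off the near shell the distance to the shell is at least (1 - 1/q) q^k, while distances from the
    origin are below q^(k+1). The constant is the quotient of the two, raised to the power n -
    alpha. *)
Lemma test_potential_near_le A k mu x : test_measure alpha q A k mu ->
  U mu x <= (\1_(near_shell k) x)%:E +
    (((1 - q^-1)^-1 * q) `^ (n%:R - alpha))%:E * U mu 0%R.
Proof.
move=> tmu; apply: (le_trans (test_potential_off_le x tmu)).
rewrite leeD2l//.
apply: (@le_trans _ _ ((((1 - q^-1)^-1 * q) `^ (n%:R - alpha))%:E *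
    (((q ^+ k.+1) `^ (alpha - n%:R))%:E * mu setT))); last first.
  by rewrite lee_pmul2l ?lte_fin ?powR_gt0 ?mulr_gt0 ?invr_gt0//; exact: test_potential0_ge tmu.
rewrite muleA -EFinM lee_wpmul2r// lee_fin -(opprB n%:R alpha) !powRN.
have qr : (q ^+ k.+1 <= ((1 - q^-1)^-1 * q) * ((1 - q^-1) * Num.max (enorm x) (q ^+ k)))%R.
  by rewrite mulrACA mulVf ?gt_eqF// mul1r exprS ler_pM2l// le_max lexx orbT.
have r0 : (0 < (1 - q^-1) * Num.max (enorm x) (q ^+ k))%R.
  by rewrite mulr_gt0// lt_max qk0 orbT.
have B0 : (0 < (1 - q^-1)^-1 * q)%R by rewrite mulr_gt0 ?invr_gt0.
rewrite ler_pdivlMr ?powR_gt0// mulrC ler_pdivrMr ?powR_gt0//.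
rewrite -powRM ?(ltW r0) ?(ltW B0)//.
apply: ge0_ler_powR => //; rewrite ?nnegrE.
- by rewrite subr_ge0 ltW.
- exact: ltW.
- exact/ltW/mulr_gt0.
Qed.

Lemma test_measure_mass_le A k mu : test_measure alpha q A k mu ->
  mu setT <= ((q ^+ k.+1) `^ (n%:R - alpha))%:E * U mu 0%R.
Proof.
move=> tmu; have := test_potential0_ge an q1 tmu.
rewrite -(opprB n%:R alpha) powRN => H.
have c0 : 0 < ((q ^+ k.+1) `^ (n%:R - alpha))%:E by rewrite lte_fin powR_gt0.
rewrite -(lee_pmul2l _ c0)// in H; apply: le_trans H.
by rewrite muleA -EFinM divff ?mul1e// gt_eqF// powR_gt0.
Qed.

(** The 8 is twice the 4 of [test_measure_exists_above], which is applied at half the capacity when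
    this is finite and positive. *)
Lemma test_measure_exists A k : exists2 mu, test_measure alpha q A k mu &
  inner_capacity alpha (shell q A k) <= (8 * 3 `^ (n%:R - alpha))%:E * mu setT.
Proof.
have p3 : (0 < 3 `^ (n%:R - alpha) :> R)%R by exact: powR_gt0.
have cap0 : 0 <= inner_capacity alpha (shell q A k).
  rewrite inve_ge0; apply: le_ereal_inf_tmp => _ [mu _ <-]; exact: energy_ge0.
have [|capy] := ltP (inner_capacity alpha (shell q A k)) +oo; last first.
  (* An infinite capacity is impossible: it would give a test measure of mass at least B + 1, but
     the mass is at most B times a potential that is at most 1. *)
  pose B := ((q ^+ k.+1) `^ (n%:R - alpha))%R.
  have [] := @test_measure_exists_above _ _ _ q an A k (4 * 3 `^ (n%:R - alpha) * (B + 1))%R.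
    by rewrite (lt_le_trans _ capy) ?ltry.
  move=> mu tmu; rewrite mulrAC divff ?mul1r; last by rewrite gt_eqF// mulr_gt0.
  move=> /le_trans/(_ (test_measure_mass_le tmu)).
  have /(lee_wpmul2l (_ : 0 <= B%:E)) : U mu 0%R <= 1 by case: tmu.
  rewrite lee_fin powR_ge0 mule1 => /(_ isT) H /le_trans/(_ H).
  by rewrite lee_fin leNgt ltrDl ltr01.
move: cap0 => /ge0_lty_EFin/[apply] -[c]; rewrite le_eqVlt => /orP[/eqP <- ->|c0 cE].
  (* At capacity 0 any test measure will do; -1 is merely a number below 0. *)
  have [|mu tmu _] := @test_measure_exists_above _ _ _ q an A k (- 1)%R.
    rewrite (@lt_le_trans _ _ 0)// ?lte_fin ?ltrN10//.
    by rewrite inve_ge0; apply: le_ereal_inf_tmp => _ [mu _ <-]; exact: energy_ge0.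
  by exists mu => //; apply: mule_ge0 => //; rewrite lee_fin mulr_ge0// ltW.
have [|mu tmu] := @test_measure_exists_above _ _ _ q an A k (c / 2)%R.
  by rewrite cE lte_fin; lra.
move=> H; exists mu => //; rewrite cE.
have c8 : 0 < (8 * 3 `^ (n%:R - alpha))%:E by rewrite lte_fin mulr_gt0.
rewrite -(lee_pmul2l _ c8)// in H; apply: le_trans H.
rewrite -EFinM lee_fin le_eqVlt; apply/orP; left; apply/eqP; field; lra.
Qed.

Lemma nneseries_lty (f : nat -> \bar R) (v : nat -> R) (N : nat) (M : R) :
  (forall k, 0 <= f k) -> (forall k, f k <= (v k)%:E) ->
  (forall L, \sum_(N <= k < L) v k <= M)%R -> \sum_(0 <= k <oo) f k < +oo.
Proof.
move=> f0 fv vM.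
have v0 k : (0 <= v k)%R by rewrite -lee_fin (le_trans (f0 k)).
apply: (@le_lt_trans _ _ (\sum_(0 <= k < N) v k + M)%:E); last exact: ltry.
apply: lime_le; first by apply: is_cvg_ereal_nneg_natsum => k _.
apply: nearW => L.
apply: (@le_trans _ _ (\sum_(0 <= k < maxn N L) v k)%:E).
  rewrite -sumEFin; apply: (@le_trans _ _ (\sum_(0 <= k < L) (v k)%:E)).
    exact: lee_sum.
  rewrite (@big_cat_nat _ _ _ L _ (maxn N L))//= ?leq_maxr// leeDl//.
  by apply: sume_ge0 => k _; rewrite lee_fin.
rewrite lee_fin (@big_cat_nat _ _ _ N _ (maxn N L))//= ?leq_maxl//.
by rewrite lerD2l.
Qed.

(** The k-th term of the thinness series is at most C u_k with C independent of k, so bounded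
    partial sums of the u_k, from any N on, would make A thin. *)
Lemma not_thin_test_sequence A : ~ inner_thin_at_infinity alpha q A ->
  exists mu : nat -> posmeasure R n, exists u : nat -> R,
  [/\ forall k, test_measure alpha q A k (mu k),
      forall k, (0 <= u k)%R /\ U (mu k) 0%R = (u k)%:E &
      forall N M, ~ (forall L, \sum_(N <= k < L) u k <= M)%R].
Proof.
move=> nthin.
have /choice[mu muP] : forall k, exists mu, test_measure alpha q A k mu /\
    inner_capacity alpha (shell q A k) <= (8 * 3 `^ (n%:R - alpha))%:E * mu setT.
  by move=> k; have [mu ? ?] := test_measure_exists A k; exists mu.
have /choice[u uP] : forall k, exists u : R, (0 <= u)%R /\ U (mu k) 0%R = u%:E.
  move=> k; have [[_ _ /(_ 0%R) U1] _] := muP k.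
  have [||r r0 rE] := @ge0_lty_EFin R (U (mu k) 0%R); [exact: potential_ge0| |by exists r].
  by rewrite (le_lt_trans U1)// ltry.
exists mu, u; split=> // [k|N M uM]; first by case: (muP k).
apply: nthin; pose C := (8 * 3 `^ (n%:R - alpha) * q `^ (n%:R - alpha))%R.
have C0 : (0 <= C)%R by rewrite !mulr_ge0 ?powR_ge0.
apply: (@nneseries_lty _ (fun k => C * u k)%R N (C * M)%R).
- move=> k; rewrite mule_ge0// inve_ge0 ?lee_fin ?powR_ge0//.
  by apply: le_ereal_inf_tmp => _ [nu _ <-]; exact: energy_ge0.
- move=> k; have [tmu cap] := muP k.
  have qkp : (q `^ (k%:R * (n%:R - alpha)) = (q ^+ k) `^ (n%:R - alpha))%R.
    by rewrite powRrM powR_mulrn// ltW.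
  have Q0 : (0 < (q ^+ k) `^ (n%:R - alpha))%R by rewrite powR_gt0.
  rewrite qkp inver gt_eqF//.
  have Q0' : 0 <= (((q ^+ k) `^ (n%:R - alpha))^-1)%:E by rewrite lee_fin invr_ge0 ltW.
  have mle := test_measure_mass_le tmu.
  rewrite (uP k).2 -EFinM in mle.
  have p3 : (0 < 8 * 3 `^ (n%:R - alpha) :> R)%R by rewrite mulr_gt0 ?powR_gt0.
  have p3' : 0 <= (8 * 3 `^ (n%:R - alpha))%:E by rewrite lee_fin ltW.
  apply: (le_trans (lee_wpmul2r Q0' cap)).
  apply: (le_trans (lee_wpmul2r Q0' (lee_wpmul2l p3' mle))).
  rewrite -!EFinM lee_fin exprS powRM ?(ltW q0) ?(ltW (qk0 _))//.
  rewrite le_eqVlt; apply/orP; left; apply/eqP; rewrite /C; field.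
  by rewrite gt_eqF.
- by move=> L; rewrite -mulr_sumr ler_wpM2l.
Qed.

End Shells.

Lemma exprn_unbounded (R : realType) (q M : R) : (1 < q)%R ->
  exists N, forall k, (N <= k)%N -> (M <= q ^+ k)%R.
Proof.
move=> q1; have q0 : (0 < q)%R by exact: lt_trans q1.
pose M' := Num.max M 1%R; have M'0 : (0 < M')%R by rewrite lt_max ltr01 orbT.
have qV : (`|q^-1| < 1)%R by rewrite gtr0_norm ?invr_gt0// invf_lt1.
have MV : (0 < M'^-1)%R by rewrite invr_gt0.
have [N _ HN] := cvgr0_norm_le _ (cvg_expr qV) _ MV.
exists N => k /HN /=; rewrite ger0_norm ?exprn_ge0 ?invr_ge0 ?(ltW q0)//.
rewrite exprVn lef_pV2 ?posrE ?exprn_gt0//; apply: le_trans.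
by rewrite le_max lexx.
Qed.

(** Continuity from below. The strict lower bound c makes the statement cover measures of infinite
    mass. *)
Lemma ball_measure_gt (R : realType) (n : nat) (mu : posmeasure R n) (c : \bar R) :
  c < mu setT -> exists j0 : nat, forall j, (j0 <= j)%N ->
    c < mu [set y : 'rV[R]_n | (enorm y <= j%:R)%R].
Proof.
move=> cmu; pose F j : set (borelRn R n) := [set y : 'rV[R]_n | (enorm y <= j%:R)%R].
have FT : \bigcup_j F j = setT.
  apply/seteqP; split => // y _; exists (Num.truncn (enorm y)).+1 => //=.
  by apply/ltW; have /andP[] := truncn_itv (enorm_ge0 y).
have cvF : (mu \o F) x @[x --> \oo] --> mu (\bigcup_j F j).
  apply: nondecreasing_cvg_mu.
  - by move=> j; exact: measurable_enorm_le.
  - by rewrite FT; exact: measurableT.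
  - move=> i j ij; apply/subsetPset => y /= /le_trans; apply.
    by rewrite ler_nat.
rewrite FT in cvF.
have nb : nbhs (mu setT) [set y | c < y].
  by apply: open_nbhs_nbhs; split => //; exact: open_ereal_gt_ereal.
by have [j0 _ H] := cvF _ nb; exists j0.
Qed.

(** * Integrals of the test potentials against a fixed measure *)

Section Asymptotics.
Context (R : realType) (n : nat) (alpha q : R).
Hypothesis an : (alpha < n%:R)%R.
Hypothesis q1 : (1 < q)%R.
Local Notation T := (borelRn R n).
Local Notation U := (@potential R n alpha).
Implicit Types (x y : 'rV[R]_n) (mu nu delta lambda : posmeasure R n).
Implicit Types (A : set 'rV[R]_n).

Let q0 : (0 < q)%R. Proof. exact: lt_trans q1. Qed.
Let qk0 k : (0 < q ^+ k)%R. Proof. exact: exprn_gt0. Qed.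
Let theta0 : (0 < 1 - q^-1)%R. Proof. by rewrite subr_gt0 invf_lt1. Qed.

(** Near shells overlap at most three times. Both contradictions below end by summing over k with
    this bound. *)
Lemma sum_integral_near_shell mu (f : T -> R) N L :
  measurable_fun setT f -> (forall x, 0 <= f x)%R ->
  \sum_(N <= k < L) \int[mu]_x (f x * \1_(near_shell q k) x)%:E <=
  3%:E * \int[mu]_x (f x)%:E.
Proof.
move=> mf f0.
have mf' k : measurable_fun setT (fun x : T => (f x * \1_(near_shell q k) x)%:E).
  apply/measurable_EFinP; apply: measurable_funM => //.
  by apply: measurable_indic; exact: measurable_near_shell.
have f0' k x : 0 <= (f x * \1_(near_shell q k) x)%:E by rewrite lee_fin mulr_ge0.
rewrite -ge0_integral_sum// -ge0_integralZl//; last 2 first.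
- exact/measurable_EFinP.
- by move=> x _; rewrite lee_fin.
apply: ge0_le_integral => //.
- by move=> x _; apply: sume_ge0.
- exact: emeasurable_sum.
- by apply/measurable_EFinP; apply: measurable_funM.
- move=> x _; rewrite sumEFin -EFinM lee_fin -mulr_sumr mulrC ler_wpM2r//.
  exact: sum_indic_near_shell.
Qed.

(** The decay |x|^(alpha-n), frozen inside the ball of radius q^k: bounded near the origin, and
    tending to 0 pointwise as k grows. *)
Definition tail_power k x : R := (Num.max (enorm x) (q ^+ k) `^ (alpha - n%:R))%R.

Lemma tail_power_ge0 k x : (0 <= tail_power k x)%R.
Proof. exact: powR_ge0. Qed.

Lemma powR_anti (a b : R) : (0 < a)%R -> (a <= b)%R ->
  (b `^ (alpha - n%:R) <= a `^ (alpha - n%:R))%R.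
Proof.
move=> a0 ab; have b0 : (0 < b)%R by exact: lt_le_trans ab.
rewrite -(opprB n%:R alpha) !powRN lef_pV2 ?posrE ?powR_gt0//.
by apply: ge0_ler_powR; rewrite ?nnegrE ?subr_ge0 ?(ltW a0) ?(ltW b0)// ltW.
Qed.

Lemma measurable_tail_power k : measurable_fun setT (tail_power k : T -> R).
Proof.
apply: (measurableT_comp (measurable_powR _)).
by apply: measurable_maxr => //; exact: measurable_enorm.
Qed.

Lemma tail_power_decr k l x : (k <= l)%N -> (tail_power l x <= tail_power k x)%R.
Proof.
move=> kl; apply: powR_anti; first by rewrite lt_max qk0 orbT.
rewrite ge_max le_max lexx/= le_max; apply/orP; right.
by rewrite ler_eXn2l.
Qed.

(** On the unit ball the integrand is at most 1, because q^k >= 1; outside it is at most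
    |x|^(alpha-n), which is integrable by the growth condition in [Mplus]. *)
Lemma integral_tail_power_lty mu k : Mplus alpha mu ->
  \int[mu]_x (tail_power k x)%:E < +oo.
Proof.
move=> [muK muI].
pose B : set T := [set y : 'rV[R]_n | (enorm y <= 1)%R].
have mB : measurable B by exact: measurable_enorm_le.
have mBC : measurable (~` B) by exact: measurableC.
have mt D : measurable_fun D (fun x : T => (tail_power k x)%:E).
  by apply: measurable_funTS; apply/measurable_EFinP; exact: measurable_tail_power.
have q1k : (1 <= q ^+ k)%R by rewrite exprn_ege1// ltW.
rewrite -(setUv B) ge0_integral_setU//; last 2 first.
- by move=> x _; rewrite lee_fin tail_power_ge0.
- by apply/disj_setPS; rewrite setICr.
apply: lte_add_pinfty.
  apply: (@le_lt_trans _ _ (\int[mu]_(x in B) cst 1 x)).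
    apply: ge0_le_integral => //.
    - by move=> x _; rewrite lee_fin tail_power_ge0.
    - move=> x _; have p1 : (1 `^ (alpha - n%:R) = 1 :> R)%R by rewrite powR1.
      rewrite lee_fin -[leRHS]p1.
      by apply: powR_anti => //; rewrite le_max q1k orbT.
  by rewrite integral_cst// mul1e; apply: muK; exact: compact_enorm_le.
apply: le_lt_trans muI.
have -> : ~` B = [set y : T | (1 < enorm (y : 'rV[R]_n))%R].
  by apply/seteqP; split => y /=; rewrite ltNge => /negP.
apply: ge0_le_integral => //.
- exact: measurable_enorm_lt.
- by move=> x _; rewrite lee_fin tail_power_ge0.
- by apply: measurable_funTS; apply/measurable_EFinP; exact: measurable_enorm_powR.
- move=> x /= x1; rewrite lee_fin; apply: powR_anti; first exact: lt_trans x1.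
  by rewrite le_max lexx.
Qed.

(** Dominated convergence, with the majorant [tail_power 0]. *)
Lemma integral_tail_power_small mu (e : R) : Mplus alpha mu -> (0 < e)%R ->
  exists N, forall k, (N <= k)%N -> \int[mu]_x (tail_power k x)%:E <= e%:E.
Proof.
move=> Mmu e0.
have mt k : measurable_fun setT (fun x : T => (tail_power k x)%:E).
  by apply/measurable_EFinP; exact: measurable_tail_power.
have cv x : (tail_power k x)%:E @[k --> \oo] --> 0%:E.
  apply/fine_cvgP; split; first exact: nearW.
  apply/cvgrPdist_le => eps eps0.
  (* This threshold is the solution r of r^(alpha-n) = eps. *)
  have [N HN] := exprn_unbounded (eps `^ (alpha - n%:R)^-1)%R q1.
  exists N => // k /HN Hk /=; rewrite sub0r normrN ger0_norm ?tail_power_ge0//.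
  have p0 : (alpha - n%:R != 0)%R by rewrite subr_eq0 lt_eqF.
  rewrite -[leRHS](powRr1 (ltW eps0)) -(mulVf p0) powRrM.
  apply: powR_anti; first exact: powR_gt0.
  by rewrite (le_trans Hk)// le_max lexx orbT.
have nb : nbhs (0 : \bar R) [set y | y < e%:E].
  apply: open_nbhs_nbhs; split; first exact: open_ereal_lt_ereal.
  by rewrite /= lte_fin.
have itp : mu.-integrable setT (fun x : T => (tail_power 0 x)%:E).
  apply/integrableP; split => //.
  under eq_integral do rewrite gee0_abs ?lee_fin ?tail_power_ge0//.
  exact: integral_tail_power_lty.
have cvI : \int[mu]_x (tail_power k x)%:E @[k --> \oo] --> \int[mu]_x (0%:E : \bar R).
  apply: (dominated_cvg measurableT _ _ _ itp).
  - by [].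
  - by move=> x _; exact: cv.
  - by [].
  - move=> k x _; rewrite gee0_abs ?lee_fin ?tail_power_ge0//.
    exact: tail_power_decr.
rewrite integral0 in cvI.
have [N _ HN] := cvI _ nb.
by exists N => k /HN/ltW.
Qed.

Lemma integral_test_potential_le A k mu delta : Mplus alpha delta ->
  test_measure alpha q A k mu ->
  \int[delta]_x U mu x <= delta (near_shell q k) +
    ((1 - q^-1) `^ (alpha - n%:R))%:E *
      (\int[delta]_x (tail_power k x)%:E) * mu setT.
Proof.
move=> Md tmu.
have Mmu : Mplus alpha mu by apply: finite_Mplus => //; case: tmu.
have muoo : mu setT < +oo by case: tmu.
have [mt m0 mE] := ge0_lty_EFin (measure_ge0 mu setT) muoo; rewrite mE.
have th0 : (0 <= (1 - q^-1) `^ (alpha - n%:R))%R by exact: powR_ge0.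
have mtp : measurable_fun setT (fun x : T => (tail_power k x)%:E).
  by apply/measurable_EFinP; exact: measurable_tail_power.
have tp0 x : 0 <= (tail_power k x)%:E by rewrite lee_fin tail_power_ge0.
have mi : measurable_fun setT (fun x : T => (\1_(near_shell q k) x)%:E : \bar R).
  by apply/measurable_EFinP; apply: measurable_indic; exact: measurable_near_shell.
apply: (@le_trans _ _ (\int[delta]_x ((\1_(near_shell q k) x)%:E +
   ((1 - q^-1) `^ (alpha - n%:R) * mt)%:E * (tail_power k x)%:E))).
  apply: ge0_le_integral => //.
  - by move=> x _; exact: potential_ge0.
  - exact: measurable_potential.
  - by apply: emeasurable_funD => //; exact: measurable_funeM.
  - move=> x _; rewrite (le_trans (test_potential_off_le an q1 x tmu))//.
    rewrite leeD2l// mE powRM ?(ltW theta0)//; last by rewrite le_max enorm_ge0.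
    by rewrite -!EFinM mulrAC.
rewrite ge0_integralD//; last 2 first.
- by move=> x _; rewrite mule_ge0// lee_fin mulr_ge0.
- exact: measurable_funeM.
rewrite ge0_integralZl ?lee_fin ?mulr_ge0// integral_indic//; last exact: measurable_near_shell.
by rewrite setIT leeD2l// EFinM muleAC.
Qed.

Lemma near_shell_lty mu k : Mplus alpha mu -> mu (near_shell q k) < +oo.
Proof.
move=> [muK _].
apply: (@le_lt_trans _ _ (mu [set y : 'rV[R]_n | (enorm y <= q ^+ k.+3 / q)%R])).
  apply: le_measure; rewrite ?inE//; first exact: measurable_near_shell.
    exact: measurable_enorm_le.
  by move=> x /= /andP[_ /ltW]; rewrite ler_pdivlMr// mulrC.
by apply: muK; exact: compact_enorm_le.
Qed.

Lemma integral_test_potential_lty A k mu delta : Mplus alpha delta ->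
  test_measure alpha q A k mu -> \int[delta]_x U mu x < +oo.
Proof.
move=> Md tmu; apply: (le_lt_trans (integral_test_potential_le Md tmu)).
apply: lte_add_pinfty; first exact: near_shell_lty.
have i0 : 0 <= \int[delta]_x (tail_power k x)%:E.
  by apply: integral_ge0 => x _; rewrite lee_fin tail_power_ge0.
rewrite lte_mul_pinfty ?mule_ge0 ?lee_fin ?powR_ge0//; last by case: tmu.
by rewrite fin_numM// ge0_fin_numE// integral_tail_power_lty.
Qed.

End Asymptotics.

(** * Two contradictions with the divergence of the u_k *)

Section Contradictions.
Context (R : realType) (n : nat) (alpha q : R).
Hypothesis an : (alpha < n%:R)%R.
Hypothesis q1 : (1 < q)%R.
Local Notation T := (borelRn R n).
Local Notation U := (@potential R n alpha).
Context (A : set 'rV[R]_n) (mu : nat -> posmeasure R n) (u : nat -> R).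
Hypothesis tmu : forall k, test_measure alpha q A k (mu k).
Hypothesis uE : forall k, (0 <= u k)%R /\ U (mu k) 0%R = (u k)%:E.
Hypothesis usum : forall N M, ~ (forall L, \sum_(N <= k < L) u k <= M)%R.
Implicit Types (x y : 'rV[R]_n) (delta lambda : posmeasure R n).

Let q0 : (0 < q)%R. Proof. exact: lt_trans q1. Qed.
Let qk0 k : (0 < q ^+ k)%R. Proof. exact: exprn_gt0. Qed.

Lemma test_sequence_not_dominated N (c M : R) (v : nat -> R) : (0 < c)%R ->
  (forall k, (N <= k)%N -> c * u k <= v k)%R ->
  ~ (forall L, \sum_(N <= k < L) v k <= M)%R.
Proof.
move=> c0 cuv vM; apply: (usum (N := N) (M := (M / c)%R)) => L.
rewrite ler_pdivlMr// mulr_suml (le_trans _ (vM L))//.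
rewrite big_nat_cond [leRHS]big_nat_cond; apply: ler_sum => k /andP[/andP[Nk _] _].
by rewrite mulrC cuv.
Qed.

Lemma Mplus_test k : Mplus alpha (mu k).
Proof. by apply: finite_Mplus => //; case: (tmu k). Qed.

(** For y in a far shell, |x| is a small fraction of |y|, so |x - y| and |y| agree within a factor C
    = K^(1/(n-alpha)), which the kernel turns into K. *)
Lemma test_potential_flat (r K : R) : (0 <= r)%R -> (1 < K)%R ->
  exists N, forall k x, (N <= k)%N -> (enorm x <= r)%R ->
    (u k)%:E <= K%:E * U (mu k) x /\ U (mu k) x <= (K * u k)%:E.
Proof.
move=> r0 K1; have p0 : (n%:R - alpha != 0)%R by rewrite subr_eq0 gt_eqF.
pose C := (K `^ (n%:R - alpha)^-1)%R.
have CK : (C `^ (n%:R - alpha) = K)%R.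
  by rewrite /C -powRrM mulVf// powRr1// ltW// (lt_trans _ K1).
have C0 : (0 < C)%R by apply: powR_gt0; exact: lt_trans K1.
have C1 : (1 < C)%R.
  rewrite ltNge; apply/negP => C1; move: K1; rewrite -CK ltNge => /negP; apply.
  have p1 : (1 `^ (n%:R - alpha) = 1 :> R)%R by rewrite powR1.
  rewrite -[leRHS]p1; apply: ge0_ler_powR; rewrite ?nnegrE ?(ltW C0)//.
  by rewrite subr_ge0 ltW.
(* With this eta, 1 - eta is exactly 1/C, and 1 + eta = 2 - 1/C is at most C because (C - 1)^2 >=
   0. *)
pose eta := (1 - C^-1)%R; have eta0 : (0 < eta)%R by rewrite subr_gt0 invf_lt1.
have [N HN] := exprn_unbounded (r / eta) q1.
exists N => k x Nk xr.
have xy y : shell q A k y -> (enorm x <= eta * enorm y)%R.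
  move=> [_ /andP[ky _]]; apply: (le_trans xr).
  have := HN _ Nk; rewrite ler_pdivrMr// mulrC => /le_trans; apply.
  by rewrite ler_pM2l.
have CC : (C * C^-1 = 1)%R by rewrite divff// gt_eqF.
have y0 y : (0 <= enorm y)%R by exact: enorm_ge0.
have xy1 y : shell q A k y -> (enorm (x - y) <= C * enorm (0 - y))%R.
  move=> /xy H; rewrite sub0r enormN (le_trans (ler_enormB _ _))//.
  rewrite (le_trans (lerD H (lexx _)))// -[X in (_ + X)%R]mul1r -mulrDl ler_wpM2r//.
  have CV : (C^-1 = 2 - C + (C - 1) ^+ 2 * C^-1)%R.
    by field; rewrite gt_eqF.
  have : (0 <= (C - 1) ^+ 2 * C^-1)%R by rewrite mulr_ge0 ?sqr_ge0 ?invr_ge0 ?(ltW C0).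
  by rewrite /eta; lra.
have xy2 y : shell q A k y -> (enorm (0 - y) <= C * enorm (x - y))%R.
  move=> /xy H; rewrite sub0r enormN.
  have H' := lerB_enorm y x; rewrite enorm_distC in H'.
  have : (C^-1 * enorm y <= enorm (x - y))%R.
    by apply: le_trans H'; move: H; rewrite /eta; lra.
  by rewrite -(ler_pM2l C0) mulrA CC mul1r.
rewrite -CK; clearbody C; have [_ uk] := uE k; split.
  have := test_potential_comparison an C0 (tmu k) xy1.
  by rewrite uk.
have := test_potential_comparison an C0 (tmu k) xy2.
by rewrite uk EFinM.
Qed.

(** Take a ball E with delta(E) >= d > 1 and lambda small outside. On E each far test potential is
    within a factor K of u_k; outside it is at most the near-shell indicator plus B u_k. Domination
    would bound a fixed multiple of u_k by the [lambda]-mass of the near shell, and these masses sum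
    to at most 3. *)
Lemma excess_mass_not_dominated delta lambda :
  Mplus alpha delta -> Mplus alpha lambda ->
  1 < delta setT -> lambda setT = 1 ->
  ~ (forall k, \int[delta]_x U (mu k) x <= \int[lambda]_x U (mu k) x).
Proof.
move=> Md Ml d1 l1 dom.
have mU k : measurable_fun setT (U (mu k) : T -> \bar R).
  by apply: measurable_potential => //; exact: Mplus_test.
have U0 k x : 0 <= U (mu k) x by exact: potential_ge0.
pose ball (j : nat) : set T := [set y : 'rV[R]_n | (enorm y <= j%:R)%R].
have mball j : measurable (ball j) by exact: measurable_enorm_le.
have [j0 Hd] := ball_measure_gt d1.
have dball j : delta (ball j) < +oo by apply: Md.1; exact: compact_enorm_le.
have [d _ dE] := ge0_lty_EFin (measure_ge0 delta (ball j0)) (dball j0).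
have d1' : (1 < d)%R by rewrite -lte_fin -dE; exact: Hd.
have [s [s1 sd]] : exists s : R, (1 < s)%R /\ (s ^+ 2 = d)%R.
  exists (Num.sqrt d); split; last by rewrite sqr_sqrtr// (le_trans _ (ltW d1')).
  by rewrite -sqrtr1 ltr_sqrt// (lt_trans _ d1').
(* K lies between 1 and the square root of d, so K^2 < d and gamma = d/K - K is positive. Below, e
   is chosen with B e = gamma/2, so half of gamma survives the error outside E. *)
pose K := ((1 + s) / 2)%R.
have K1 : (1 < K)%R by rewrite /K; lra.
have K0 : (0 < K)%R by exact: lt_trans K1.
have Kd : (K * K < d)%R by rewrite -sd /K expr2; nra.
pose gamma := (d / K - K)%R.
have gamma0 : (0 < gamma)%R by rewrite subr_gt0 ltr_pdivlMr.
pose B := (((1 - q^-1)^-1 * q) `^ (n%:R - alpha))%R.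
have B0 : (0 < B)%R.
  by rewrite powR_gt0// mulr_gt0// invr_gt0 subr_gt0 invf_lt1.
pose e := (gamma / (2 * B))%R.
have e0 : (0 < e)%R by rewrite divr_gt0// mulr_gt0.
have le1 : (1 - e)%:E < lambda setT by rewrite l1 lte_fin ltrBlDr ltrDl.
have [j1 Hl] := ball_measure_gt le1.
pose E := ball (maxn j0 j1).
have mEC : measurable (~` E) by apply: measurableC; exact: mball.
have lEC : lambda (~` E) <= e%:E.
  have lE : (1 - e)%:E < lambda E by apply: Hl; exact: leq_maxr.
  have lD : lambda E + lambda (~` E) = 1.
    by rewrite -measureU ?setUv ?setICr//; exact: mball.
  have loo : lambda setT < +oo by rewrite l1 ltry.
  have fin D : measurable D -> lambda D < +oo.
    by move=> mD; apply: le_lt_trans loo; apply: le_measure; rewrite ?inE.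
  have [a _ aE] := ge0_lty_EFin (measure_ge0 lambda E) (fin _ (mball _)).
  have [b _ bE] := ge0_lty_EFin (measure_ge0 lambda (~` E)) (fin _ mEC).
  move: lE lD; rewrite aE bE lte_fin -EFinD lee_fin => ? [?]; lra.
have dE' : d%:E <= delta E.
  rewrite -dE; apply: le_measure; rewrite ?inE; [exact: mball|exact: mball|].
  by move=> y /= /le_trans; apply; rewrite ler_nat leq_maxl.
have [N HN] := test_potential_flat (ler0n R (maxn j0 j1)) K1.
have mnear k : measurable (near_shell q k : set T) by exact: measurable_near_shell.
pose v k := fine (lambda (near_shell q k)).
have vE k : lambda (near_shell q k) = (v k)%:E.
  by rewrite fineK// ge0_fin_numE//; exact: (near_shell_lty q1 k Ml).
clearbody v.
have gamma2 : (0 < gamma / 2)%R by rewrite divr_gt0.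
apply: (@test_sequence_not_dominated N (gamma / 2) 3 v) => //.
- move=> k Nk; have [uk0 _] := uE k.
  have low : (u k / K * d)%:E <= \int[delta]_x U (mu k) x.
    apply: (@le_trans _ _ (\int[delta]_(x in E) U (mu k) x)); last first.
      by apply: ge0_subset_integral => //; exact: mball.
    apply: (@le_trans _ _ (\int[delta]_(x in E) cst (u k / K)%:E x)).
      rewrite integral_cst; last exact: mball.
      by rewrite EFinM lee_wpmul2l// lee_fin divr_ge0// ltW.
    apply: ge0_le_integral => //; first exact: mball.
    - by move=> x _; rewrite lee_fin divr_ge0// ltW.
    - exact: measurable_funTS.
    - move=> x xE; have [H _] := HN k x Nk xE.
      rewrite -(lee_pmul2l _ (_ : 0 < K%:E)) ?lte_fin//.
      by rewrite -EFinM mulrCA divff ?mulr1// gt_eqF.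
  have up : \int[lambda]_x U (mu k) x <= (K * u k + v k + B * u k * e)%:E.
    have m1 : measurable_fun setT (fun x : T => (\1_(near_shell q k) x)%:E : \bar R).
      by apply/measurable_EFinP; exact: measurable_indic.
    have m2 : measurable_fun setT (fun x : T => (\1_(~` E) x)%:E : \bar R).
      by apply/measurable_EFinP; exact: measurable_indic.
    apply: (@le_trans _ _ (\int[lambda]_x (((K * u k)%:E + (\1_(near_shell q k) x)%:E)
        + (B * u k)%:E * (\1_(~` E) x)%:E))).
      apply: ge0_le_integral => //.
      - apply: emeasurable_funD; last exact: measurable_funeM.
        by apply: emeasurable_funD.
      - move=> x _; have [xE|xE] := pselect (E x).
          have [_ H] := HN k x Nk xE; rewrite (le_trans H)// -!EFinM -!EFinD lee_fin.
          by rewrite -addrA lerDl addr_ge0// mulr_ge0// mulr_ge0// ltW.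
        have -> : \1_(~` E) x = 1%R :> R by rewrite indicE mem_set.
        have := test_potential_near_le an q1 x (tmu k).
        rewrite (uE k).2 => /le_trans; apply.
        by rewrite -!EFinM -!EFinD lee_fin mulr1 lerD2r lerDr mulr_ge0// ltW.
    have Bu0 : 0 <= (B * u k)%:E by rewrite lee_fin mulr_ge0// ltW.
    have g1 (x : T) : 0 <= (K * u k)%:E by rewrite lee_fin mulr_ge0// ltW.
    have g2 (x : T) : 0 <= (\1_(near_shell q k) x)%:E :> \bar R by rewrite lee_fin.
    have g3 (x : T) : 0 <= (\1_(~` E) x)%:E :> \bar R by rewrite lee_fin.
    rewrite (ge0_integralD lambda measurableT (fun x _ => adde_ge0 (g1 x) (g2 x))
      (emeasurable_funD (measurable_cst _) m1) (fun x _ => mule_ge0 Bu0 (g3 x))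
      (measurable_funeM _ m2)).
    rewrite (ge0_integralD lambda measurableT (fun x _ => g1 x) (measurable_cst _)
      (fun x _ => g2 x) m1).
    rewrite (ge0_integralZl lambda measurableT m2 (fun x _ => g3 x) Bu0).
    rewrite integral_cst// !integral_indic// !setIT l1 mule1 vE.
    by rewrite [leRHS]EFinD leeD2l// [leRHS]EFinM lee_wpmul2l.
  have := le_trans low (le_trans (dom k) up); rewrite lee_fin.
  have Be : (B * u k * e = gamma / 2 * u k)%R.
    by rewrite /e; field; rewrite gt_eqF.
  have -> : (u k / K * d = (gamma + K) * u k)%R.
    by rewrite /gamma subrK mulrC mulrCA mulrC.
  rewrite Be; lra.
- move=> L.
  have := @sum_integral_near_shell _ _ q q1 lambda (cst 1%R) N L (measurable_cst _) (fun _ => ler01).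
  under eq_bigr do under eq_integral do rewrite mul1r.
  under eq_bigr do rewrite integral_indic// setIT vE.
  have -> : \int[lambda]_x (cst 1%R x)%:E = 1 :> \bar R.
    by rewrite -[RHS]l1 -[RHS]mul1e -(integral_cst lambda measurableT).
  by rewrite mule1 sumEFin lee_fin.
Qed.

(** Far test potentials are small off their near shell in [delta]-mean, so the lower bound forces
    the near shell to have [delta]-mass at least eta/2 times the mass of [mu k]. Weighted by
    [tail_power 0], this mass dominates a multiple of u_k, while the weighted masses have a finite
    sum. *)
Lemma potential_not_bounded_below delta (eta : R) N0 : Mplus alpha delta ->
  (0 < eta)%R ->
  ~ (forall k, (N0 <= k)%N ->
      eta%:E * mu k setT <= \int[delta]_x U (mu k) x).
Proof.
move=> Md eta0 low.
pose th := ((1 - q^-1) `^ (alpha - n%:R))%R.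
have th0 : (0 < th)%R by rewrite powR_gt0// subr_gt0 invf_lt1.
(* A tail integral below this value makes the off-shell contribution at most half of eta times the
   mass of [mu k]. *)
have eth : (0 < eta / (2 * th))%R by rewrite divr_gt0// mulr_gt0.
have [N1 HN1] := integral_tail_power_small an q1 Md eth.
have mnear k : measurable (near_shell q k : set T) by exact: measurable_near_shell.
have mtp : measurable_fun setT (tail_power alpha q 0%N : T -> R).
  exact: measurable_tail_power.
have tp0 (x : T) : (0 <= tail_power alpha q 0%N x)%R by exact: tail_power_ge0.
have tpoo := integral_tail_power_lty an q1 0%N Md.
pose h k (x : T) : \bar R := (tail_power alpha q 0%N x * \1_(near_shell q k) x)%:E.
have h0 k x : 0 <= h k x by rewrite lee_fin mulr_ge0.
have mh k : measurable_fun setT (h k).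
  by apply/measurable_EFinP; apply: measurable_funM => //; exact: measurable_indic.
have hoo k : \int[delta]_x h k x < +oo.
  apply: le_lt_trans tpoo; apply: ge0_le_integral => //.
    exact/measurable_EFinP.
  move=> x _; rewrite lee_fin; apply: ler_piMr; first exact: tp0.
  by rewrite indicE; case: (x \in _).
pose v k := fine (\int[delta]_x h k x).
have vE k : \int[delta]_x h k x = (v k)%:E.
  by rewrite fineK// ge0_fin_numE// integral_ge0.
have tpI k : 0 <= \int[delta]_x (tail_power alpha q k x)%:E.
  by apply: integral_ge0 => x _; rewrite lee_fin tail_power_ge0.
have [F _ FE] := ge0_lty_EFin (tpI 0%N) tpoo.
(* On the near shell |x| < q^(k+2), while u_k is compared with the mass at radius q^k; the factor
   q^2 accounts for the difference. *)
pose c := (eta / 2 / (q ^+ 2) `^ (n%:R - alpha))%R.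
have c0 : (0 < c)%R by rewrite !divr_gt0// powR_gt0// exprn_gt0.
apply: (@test_sequence_not_dominated (maxn N0 N1) c (3 * F)%R v) => //.
- move=> k; rewrite geq_max => /andP[kN0 kN1].
  have muoo : mu k setT < +oo by case: (tmu k).
  have [m m0 mE] := ge0_lty_EFin (measure_ge0 (mu k) setT) muoo.
  have [D D0 DE] := ge0_lty_EFin (measure_ge0 delta (near_shell q k)) (near_shell_lty q1 k Md).
  have [g g0 gE] := ge0_lty_EFin (tpI k)
    (integral_tail_power_lty an q1 k Md).
  have gle : (g <= eta / (2 * th))%R by rewrite -lee_fin -gE; exact: HN1.
  have etaD : (eta / 2 * m <= D)%R.
    have := le_trans (low _ kN0) (integral_test_potential_le an q1 Md (tmu k)).
    rewrite DE gE mE -!EFinM -EFinD lee_fin -/th.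
    have : (th * g * m <= eta / 2 * m)%R.
      rewrite ler_wpM2r// mulrC -ler_pdivlMr// -mulrA -invfM.
      by [].
    lra.
  have um : (u k <= (q ^+ k) `^ (alpha - n%:R) * m)%R.
    have := test_potential0_le an q1 (tmu k).
    by rewrite (uE k).2 mE -EFinM lee_fin.
  have Dv : (D * (q ^+ k.+2) `^ (alpha - n%:R) <= v k)%R.
    have DI : D%:E = \int[delta]_x (\1_(near_shell q k) x)%:E.
      by rewrite integral_indic// setIT DE.
    have m1 : measurable_fun setT (fun x : T => (\1_(near_shell q k) x)%:E : \bar R).
      by apply/measurable_EFinP; exact: measurable_indic.
    rewrite -lee_fin -vE mulrC EFinM DI -ge0_integralZl//; last first.
      by rewrite lee_fin powR_ge0.
    apply: ge0_le_integral => //.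
    - by move=> x _; rewrite mule_ge0 ?lee_fin ?powR_ge0.
    - exact: measurable_funeM.
    - move=> x _; rewrite /h EFinM indicE mem_near_shell.
      case: andP => [[_ xk]|_]; last by rewrite !mule0.
      rewrite !mule1 lee_fin; apply: powR_anti => //.
        by rewrite lt_max expr0 ltr01 orbT.
      rewrite ge_max expr0 exprn_ege1 ?(ltW q1)// andbT.
      by rewrite -(ler_pM2l q0) -exprS ltW.
  have q2 : ((q ^+ k.+2) `^ (alpha - n%:R) =
      (q ^+ k) `^ (alpha - n%:R) / (q ^+ 2) `^ (n%:R - alpha))%R.
    rewrite -addn2 exprD powRM ?exprn_ge0 ?(ltW q0)//.
    by rewrite -[in X in (_ * X)%R](opprB n%:R alpha) powRN.
  apply: le_trans Dv; rewrite q2 /c.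
  have Q0 : (0 <= (q ^+ k) `^ (alpha - n%:R))%R by exact: powR_ge0.
  have V0 : (0 <= ((q ^+ 2) `^ (n%:R - alpha))^-1)%R by rewrite invr_ge0 powR_ge0.
  rewrite mulrA [X in (X <= _)%R]mulrAC ler_wpM2r//.
  apply: (@le_trans _ _ (eta / 2 * ((q ^+ k) `^ (alpha - n%:R) * m)))%R.
    by rewrite ler_wpM2l// ltW// divr_gt0.
  by rewrite mulrCA mulrC ler_wpM2r.
- move=> L; have := sum_integral_near_shell q1 delta (maxn N0 N1) L mtp tp0.
  under eq_bigr do rewrite -/(h _ _) vE.
  by rewrite FE sumEFin -EFinM lee_fin.
Qed.

End Contradictions.

(** * Vanishing of the minimizer far out, and compactness of its support *)

Lemma minimizer_null_where_small (R : realType) (n : nat) (alpha : R)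
    (A : set 'rV[R]_n) (lambda delta : posmeasure R n) (a s : R)
    (E : set (borelRn R n)) :
  (alpha < n%:R)%R -> Mplus alpha delta ->
  is_minimizer alpha A (fun x => - potential alpha delta x) lambda ->
  energy alpha lambda = a%:E -> \int[lambda]_x potential alpha delta x = s%:E ->
  (a < s)%R -> measurable E ->
  (forall x, A x -> ~ E x -> potential alpha delta x <= ((s - a) / 2)%:E) ->
  lambda (~` E) = 0.
Proof.
move=> an Md lmin aE sE as_ mE small.
have [[[[Ml _] [_ lA]] l1] _] := lmin.1.
have mEC : measurable (~` E) by exact: measurableC.
have loo : lambda setT < +oo by rewrite l1 ltry.
have fin D : measurable D -> lambda D < +oo.
  by move=> mD; apply: le_lt_trans loo; apply: le_measure; rewrite ?inE.
have mU nu : Mplus alpha nu ->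
    measurable_fun setT (potential alpha nu : borelRn R n -> \bar R).
  by move=> ?; exact: measurable_potential.
have U0 nu x : 0 <= potential alpha nu x by exact: potential_ge0.
(* The restriction of [lambda] to E is the test measure; its potential is at most that of [lambda],
   so its energy is finite. *)
pose mu : posmeasure R n := mrestr lambda mE.
have Mmu : Mplus alpha mu by exact: Mplus_mrestr.
have muT : mu setT = lambda E by rewrite /mu /= /mrestr setTI.
have muI nu : Mplus alpha nu -> \int[mu]_x potential alpha nu x =
    \int[lambda]_(x in E) potential alpha nu x.
  by move=> Mnu; apply: ge0_integral_mrestr => //; exact: mU.
have mule x : potential alpha mu x <= potential alpha lambda x.
  rewrite /mu /potential ge0_integral_mrestr//.
  - apply: ge0_subset_integral => //; first exact: measurable_riesz_kernel_l.
    by move=> y _; exact: riesz_kernel_ge0.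
  - exact: measurable_riesz_kernel_l.
  - by move=> y; exact: riesz_kernel_ge0.
have muA : mu.-negligible (~` A).
  have [N [mN lN AN]] := lA; exists N; split => //.
  by apply: (@subset_measure0 _ _ _ lambda (N `&` E) N) => //; exact: measurableI.
clearbody mu.
have split_ nu : Mplus alpha nu -> \int[lambda]_x potential alpha nu x =
    \int[lambda]_(x in E) potential alpha nu x +
    \int[lambda]_(x in ~` E) potential alpha nu x.
  move=> Mnu; rewrite -ge0_integral_setU//.
  - by rewrite setUv.
  - by rewrite setUv; exact: mU.
  - by apply/disj_setPS; rewrite setICr.
have I0 nu D : 0 <= \int[lambda]_(x in D) potential alpha nu x.
  by apply: integral_ge0.
have Ile nu D : Mplus alpha nu -> measurable D ->
    \int[lambda]_(x in D) potential alpha nu x <= \int[lambda]_x potential alpha nu x.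
  by move=> Mnu mD; apply: ge0_subset_integral => //; exact: mU.
have aE' : \int[lambda]_x potential alpha lambda x = a%:E.
  by rewrite -aE /energy mutual_energyE.
have soo : \int[lambda]_x potential alpha delta x < +oo by rewrite sE ltry.
have aoo : \int[lambda]_x potential alpha lambda x < +oo by rewrite aE' ltry.
have emu : energy alpha mu < +oo.
  rewrite /energy mutual_energyE (muI _ Mmu); apply: le_lt_trans aoo.
  apply: le_trans (Ile _ _ Ml mE); apply: ge0_le_integral => //.
  - by apply: measurable_funTS; exact: mU.
  - by apply: measurable_funTS; exact: mU.
have := minimizer_variation an Md lmin Mmu _ muA emu _ _.
rewrite muT !muI// aE sE => /(_ (fin _ mE) (le_lt_trans (Ile _ _ Md mE) soo)
  (le_lt_trans (Ile _ _ Ml mE) aoo)).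
have [m _ mEq] := ge0_lty_EFin (measure_ge0 lambda E) (fin _ mE).
have [m' m'0 mCEq] := ge0_lty_EFin (measure_ge0 lambda (~` E)) (fin _ mEC).
have [t _ tE] := ge0_lty_EFin (I0 delta E) (le_lt_trans (Ile _ _ Md mE) soo).
have [t' _ tCE] := ge0_lty_EFin (I0 delta (~` E)) (le_lt_trans (Ile _ _ Md mEC) soo).
have [b _ bE] := ge0_lty_EFin (I0 lambda E) (le_lt_trans (Ile _ _ Ml mE) aoo).
have [b' b'0 bCE] := ge0_lty_EFin (I0 lambda (~` E)) (le_lt_trans (Ile _ _ Ml mEC) aoo).
have mm : (m + m' = 1)%R.
  have : lambda E + lambda (~` E) = 1 by rewrite -measureU ?setUv ?setICr.
  by rewrite mEq mCEq -EFinD => -[].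
have tt : (s = t + t')%R by have := split_ _ Md; rewrite sE tE tCE -EFinD => -[].
have bb : (a = b + b')%R by have := split_ _ Ml; rewrite aE' bE bCE -EFinD => -[].
have t'le : (t' <= (s - a) / 2 * m')%R.
  rewrite -lee_fin -tCE EFinM -mCEq -integral_cst//.
  apply: ae_ge0_le_integral => //.
  - by apply: measurable_funTS; exact: mU.
  - by move=> x _; rewrite lee_fin divr_ge0// subr_ge0 ltW.
  - apply: negligibleS lA => x /= H Ax; apply: H => Ex; exact: small.
rewrite mEq tE bE -!EFinM -!EFinD lee_fin mCEq => H.
congr (_%:E); apply/eqP; rewrite eq_le m'0 andbT.
(* Splitting a, s and the mass 1 over E and its complement turns H into (s - a) m' <= t' - b'. Here
   b' >= 0 and t' is at most half of (s - a) m'. *)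
have : ((s - a) / 2 * m' <= 0)%R by nra.
by rewrite pmulr_rle0// divr_gt0// subr_gt0.
Qed.

Lemma compact_msupport (R : realType) (n : nat) (mu : posmeasure R n) (r : R) :
  mu [set x : 'rV[R]_n | ~ (enorm x <= r)%R] = 0 -> compact (msupport mu).
Proof.
move=> mur; apply: subclosed_compact (@compact_enorm_le R n r) _.
  by apply: open_closedC; apply: bigcup_open => V [].
move=> x /= nV; apply: contrapT => xr; apply: nV.
exists [set x : 'rV[R]_n | ~ (enorm x <= r)%R] => //; split => //.
rewrite (_ : [set _ | _] = @enorm R n @^-1` [set z | (r < z)%R]); last first.
  by apply/seteqP; split => y /=; rewrite ltNge => /negP.
by apply: open_comp; [move=> y _; exact: continuous_enorm|exact: open_gt].
Qed.
Theorem theorem2p22 (R : realType) (n : nat) (alpha q : R)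
    (A : set 'rV[R]_n) (tau sigma lambda : posmeasure R n) :
  (2 <= n)%N ->
  (0 < alpha <= 2)%R ->
  (alpha < n%:R)%R ->
  (1 < q)%R ->
  strongly_closed_in_Eplus alpha (Eplus_on alpha A) ->
  ~ inner_thin_at_infinity alpha q A ->
  Eplus alpha tau ->
  Mplus alpha sigma ->
  bounded_measure sigma ->
  0 < ereal_inf [set (enorm (x - y))%:E | x in msupport sigma & y in A] ->
  let delta : posmeasure R n := measure_add tau sigma in
  1 < delta setT ->
  {within closure A, continuous (potential alpha delta)} ->
  (exists l : \bar R,
     potential alpha delta x @[x --> within A (@nbhs_infty R n)] --> l) ->
  is_minimizer alpha A (fun x => - potential alpha delta x) lambda ->
  compact (msupport lambda).
Proof.
move=> _ _ an q1 _ nthin [Mtau _] Msigma _ _ delta d1 _ [l Ul] lmin.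
have Md : Mplus alpha delta by exact: Mplus_measure_add.
clearbody delta; clear tau sigma Mtau Msigma.
have [[[[Ml el] _] l1] _] := lmin.1.
have soo := minimizer_finite Md lmin.
have U0 (nu : posmeasure R n) x : 0 <= potential alpha nu x by exact: potential_ge0.
have mU (nu : posmeasure R n) : Mplus alpha nu ->
    measurable_fun setT (potential alpha nu : borelRn R n -> \bar R).
  by move=> ?; exact: measurable_potential.
have I0 (m nu : posmeasure R n) : 0 <= \int[m]_x potential alpha nu x by apply: integral_ge0.
have [a _ aE] := ge0_lty_EFin (energy_ge0 alpha lambda) el.
have [s _ sE] := ge0_lty_EFin (I0 lambda delta) soo.
have [mu [u [tmu uE usum]]] := not_thin_test_sequence an q1 nthin.
have Mmu k : Mplus alpha (mu k) by exact: Mplus_test tmu k.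
(* If a >= s, the variational inequality with [mu k] gives int U^delta dmu_k <= int U^lambda dmu_k
   for every k; exchanging the integrals yields the domination already excluded. *)
have as_ : (a < s)%R.
  rewrite ltNge; apply/negP => sa.
  apply: (excess_mass_not_dominated an q1 tmu uE usum Md Ml d1 l1) => k.
  have muoo : mu k setT < +oo by case: (tmu k).
  have doo := integral_test_potential_lty an q1 Md (tmu k).
  have loo := integral_test_potential_lty an q1 Ml (tmu k).
  have dC := integral_potentialC an Md (Mmu k).
  have lC := integral_potentialC an Ml (Mmu k).
  (* The potential of [mu k] is at most 1, so its energy is at most its mass. *)
  have emu : energy alpha (mu k) < +oo.
    rewrite /energy mutual_energyE; apply: le_lt_trans muoo.
    rewrite -[leRHS]mul1e -integral_cst//; apply: ge0_le_integral => //.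
      exact: mU.
    by move=> x _; case: (tmu k).
  have dmu : \int[mu k]_x potential alpha delta x < +oo by rewrite dC.
  have lmu : \int[mu k]_x potential alpha lambda x < +oo by rewrite lC.
  have := minimizer_variation an Md lmin (Mmu k) muoo (test_measureS (tmu k)) emu dmu lmu.
  rewrite dC lC aE sE.
  have [m m0 ->] := ge0_lty_EFin (measure_ge0 (mu k) setT) muoo.
  have [b _ ->] := ge0_lty_EFin (I0 delta (mu k)) doo.
  have [c _ ->] := ge0_lty_EFin (I0 lambda (mu k)) loo.
  rewrite -!EFinM -!EFinD !lee_fin; nra.
pose eta := ((s - a) / 2)%R.
have eta0 : (0 < eta)%R by rewrite divr_gt0// subr_gt0.
(* It suffices to exclude l >= eta, where eta is the threshold of [minimizer_null_where_small]; l =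
   0 need not be derived separately. *)
have [leta|etal] := ltP l eta%:E.
  have nb : nbhs l [set z | z < eta%:E].
    by apply: open_nbhs_nbhs; split => //; exact: open_ereal_lt_ereal.
  have [M HM] := Ul _ nb.
  apply: (@compact_msupport _ _ _ M).
  apply: (minimizer_null_where_small an Md lmin aE sE as_ (measurable_enorm_le M)).
  move=> x Ax /negP; rewrite -ltNge => Mx.
  by apply: ltW; exact: HM.
have nb : nbhs l [set z | (eta / 2)%:E < z].
  apply: open_nbhs_nbhs; split; first exact: open_ereal_gt_ereal.
  by rewrite /= (lt_le_trans _ etal)// lte_fin; lra.
have [M HM] := Ul _ nb.
(* The summand 1 puts the whole far shell strictly outside the ball of radius M. There U^delta
   exceeds eta/2, and integrating against [mu k] gives the excluded lower bound. *)
have [N HN] := exprn_unbounded (M + 1) q1.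
have eta2 : (0 < eta / 2)%R by rewrite divr_gt0.
exfalso; apply: (potential_not_bounded_below an q1 tmu uE usum (N0 := N) Md eta2).
move=> k /HN Mk; rewrite -(integral_potentialC an Md (Mmu k)) -integral_cst//.
have [_ muk _] := tmu k.
apply: (negligible_ge0_le_integral muk) => //.
- by move=> x; rewrite lee_fin ltW.
- exact: mU.
- move=> x [Ax /andP[kx _]]; apply: ltW; apply: HM => //.
  by apply: lt_le_trans kx; apply: lt_le_trans Mk; rewrite ltrDl.
Qed.
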